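(* Let $\Bbbk$ be a field (of arbitrary characteristic), let $G=\langle g\rangle\cong(\mathbb{Z},+)$ (written multiplicatively), let $\chi:G\times G\to\Bbbk^\times$ be the antisymmetric bicharacter with $\chi(g,g)=-1$, and let $\mathcal{C}$ be the category of $(G,\chi)$-color vector spaces over $\Bbbk$, viewed as a Cartier category with zero infinitesimal braiding. Let $\mathfrak{f}=\Bbbk s$ be a one-dimensional object of $\mathcal{C}$ of $G$-degree $1$, regarded as a Lie bialgebra in $\mathcal{C}$ with zero bracket and zero cobracket. Let $J^-$ be the four-dimensional $G$-graded vector space with basis $x_{11},x_{12},x_{21},x_{22}$, where $x_{ij}\in J^-_{g^i}$ for all $i,j\in\{1,2\}$, and put $x_{i0}=0$ for $i\in\{1,2\}$. Regard $J^-$ as an object of the category ${}^{\mathfrak{f}}_{\mathfrak{f}}\mathcal{C}$ of left crossed modules over $\mathfrak{f}$ in $\mathcal{C}$ via the coaction $\lambda$ and action $\alpha$ of $\mathfrak{f}$ given by $$\lambda(x_{ij})=is\otimes x_{ij},\qquad s\cdot x_{ij}=x_{i,j-1}\qquad\text{for all }i,j\in\{1,2\},$$ where $s\cdot x=\alpha(s\otimes x)$ for all $x\in J^-$ (these formulas do define a crossed module). Then $J^-$ is a (curved) Lie bialgebra in $({}^{\mathfrak{f}}_{\mathfrak{f}}\mathcal{C},\widehat{\eta})$ with the natural (non-zero) infinitesimal braiding $\widehat{\eta}$ of ${}^{\mathfrak{f}}_{\mathfrak{f}}\mathcal{C}$ and the following bracket $\beta$ and cobracket $\delta$: $$\beta(x_{1i}\otimes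 x_{1j})=(i+j-2)\,x_{2,i+j-2},\qquad \beta(x_{2i}\otimes x)=\beta(x\otimes x_{2i})=0,$$ $$\delta(x_{1i})=0,\qquad \delta(x_{2i})=(\tau-\mathrm{id})(x_{11}\otimes x_{1i})=-x_{11}\otimes x_{1i}-x_{1i}\otimes x_{11}$$ for all $i,j\in\{1,2\}$ and all $x\in J^-$.
   Context: **Color vector spaces.** For an abelian group $G$ (written multiplicatively, neutral element $1$) and a field $\Bbbk$, an antisymmetric bicharacter is a map $\chi:G\times G\to\Bbbk^\times$ with $\chi(g_1,g_2)\chi(g_2,g_1)=1$ and $\chi(g_1g_2,h)=\chi(g_1,h)\chi(g_2,h)$. The category of $(G,\chi)$-color vector spaces is the category of $G$-graded $\Bbbk$-vector spaces and degree-preserving linear maps, with the usual graded tensor product and the symmetry $\tau_{V,W}(v\otimes w)=\chi(a,b)\,w\otimes v$ for $v\in V_a$, $w\in W_b$. (Monoidal categories are treated as strict.) In particular, here $\tau(x_{ij}\otimes x_{kl})=(-1)^{ik}x_{kl}\otimes x_{ij}$. **Cartier categories.** A Cartier category $(\mathcal{C},\eta)$ is a symmetric monoidal category $\mathcal{C}$ (symmetry $\tau$) with hom-sets abelian groups and biadditive composition and tensor product of morphisms, together with a natural transformation $\eta=(\eta_{X,Y}:X\otimes Y\to X\otimes Y)$ of $\otimes$ to itself (the infinitesimal braiding) with $$\eta_{X,Y\otimes Z}=\eta_{X,Y}\otimes\mathrm{id}_Z+(\tau_{Y,X}\otimes\mathrm{id}_Z)(\mathrm{id}_Y\otimes\eta_{X,Z})(\tau_{X,Y}\otimes\mathrm{id}_Z),\qquad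 \eta_{Y,X}\tau_{X,Y}=\tau_{X,Y}\eta_{X,Y}.$$ Below $\tau_{12}$ denotes $\tau$ applied to the first two tensor factors. **Lie structures.** A Lie algebra in $\mathcal{C}$ is $(\mathfrak{g},\beta)$, $\beta:\mathfrak{g}\otimes\mathfrak{g}\to\mathfrak{g}$, with $\beta(\mathrm{id}+\tau)=0$ and $\beta(\beta\otimes\mathrm{id})=\beta(\mathrm{id}\otimes\beta)(\mathrm{id}-\tau_{12})$. A Lie coalgebra is $(\mathfrak{g},\delta)$, $\delta:\mathfrak{g}\to\mathfrak{g}\otimes\mathfrak{g}$, with $(\mathrm{id}+\tau)\delta=0$ and $(\delta\otimes\mathrm{id})\delta=(\mathrm{id}-\tau_{12})(\mathrm{id}\otimes\delta)\delta$. A Lie bialgebra in $(\mathcal{C},\eta)$ (also called curved Lie bialgebra) is $(\mathfrak{g},\beta,\delta)$ with $(\mathfrak{g},\beta)$ a Lie algebra, $(\mathfrak{g},\delta)$ a Lie coalgebra in $\mathcal{C}$ and $$\delta\beta=(\mathrm{id}-\tau)(\beta\otimes\mathrm{id})(\mathrm{id}\otimes\tau)(\delta\otimes\mathrm{id})(\mathrm{id}-\tau)+(\tau-\mathrm{id})\eta_{\mathfrak{g},\mathfrak{g}}.$$ **Crossed modules.** A left crossed module over a Lie bialgebra $(\mathfrak{f},\beta_{\mathfrak{f}},\delta_{\mathfrak{f}})$ in $(\mathcal{C},\eta)$ is $(V,\alpha,\lambda)$ with morphisms $\alpha:\mathfrak{f}\otimes V\to V$, $\lambda:V\to\mathfrak{f}\otimes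 V$ in $\mathcal{C}$ satisfying $\alpha(\beta_{\mathfrak{f}}\otimes\mathrm{id})=\alpha(\mathrm{id}\otimes\alpha)(\mathrm{id}-\tau_{12})$ (Lie module), $(\delta_{\mathfrak{f}}\otimes\mathrm{id})\lambda=(\mathrm{id}-\tau_{12})(\mathrm{id}\otimes\lambda)\lambda$ (Lie comodule) and $$\lambda\alpha=(\beta_{\mathfrak{f}}\otimes\mathrm{id})(\mathrm{id}\otimes\lambda)+(\mathrm{id}\otimes\alpha)(\tau_{\mathfrak{f},\mathfrak{f}}\otimes\mathrm{id})(\mathrm{id}\otimes\lambda)+(\mathrm{id}\otimes\alpha)(\delta_{\mathfrak{f}}\otimes\mathrm{id})-\eta_{\mathfrak{f},V}.$$ Morphisms in ${}^{\mathfrak{f}}_{\mathfrak{f}}\mathcal{C}$ are morphisms in $\mathcal{C}$ commuting with actions and coactions; on tensor products $\alpha_{V\otimes W}=\alpha_V\otimes\mathrm{id}_W+(\mathrm{id}_V\otimes\alpha_W)(\tau_{\mathfrak{f},V}\otimes\mathrm{id}_W)$ and $\lambda_{V\otimes W}=\lambda_V\otimes\mathrm{id}_W+(\tau_{V,\mathfrak{f}}\otimes\mathrm{id}_W)(\mathrm{id}_V\otimes\lambda_W)$; the symmetry is $\tau$. The natural infinitesimal braiding of ${}^{\mathfrak{f}}_{\mathfrak{f}}\mathcal{C}$ is $$\widehat{\eta}_{V,W}=\zeta_{W,V}\tau_{V,W}+\tau_{W,V}\zeta_{V,W}+\eta_{V,W},\qquad \zeta_{V,W}=(\alpha_W\otimes\mathrm{id}_V)(\mathrm{id}_{\mathfrak{f}}\otimes\tau_{V,W})(\lambda_V\otimes\mathrm{id}_W),$$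 and $({}^{\mathfrak{f}}_{\mathfrak{f}}\mathcal{C},\widehat{\eta})$ is a Cartier category. Here $\eta=0$ on $\mathcal{C}$. Lie bialgebras in $({}^{\mathfrak{f}}_{\mathfrak{f}}\mathcal{C},\widehat{\eta})$ have bracket and cobracket that are morphisms in ${}^{\mathfrak{f}}_{\mathfrak{f}}\mathcal{C}$, and the compatibility condition uses $\widehat{\eta}$ in place of $\eta$. *)

(* Defs.v *)
From HB Require Import structures.
From mathcomp Require Import all_boot all_order all_algebra.
From mathcomp Require Import boolp.

Set Implicit Arguments.
Unset Strict Implicit.
Unset Printing Implicit Defensive.

Import GRing.Theory.
Local Open Scope ring_scope.
Local Open Scope quotient_scope.

Definition mk_linear (R : nzRingType) (U V : lmodType R) (f : U -> V)
    (H : linear f) : {linear U -> V} :=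
  HB.pack f (GRing.isLinear.Build R U V *:%R f H).

Definition is_bilinear (R : nzRingType) (U V W : lmodType R)
    (f : U -> V -> W) : Prop :=
  (forall v a u u', f (a *: u + u') v = a *: f u v + f u' v) /\
  (forall u a v v', f u (a *: v + v') = a *: f u v + f u v').

Definition mk_bilinear (R : nzRingType) (U V W : lmodType R) (f : U -> V -> W)
    (H : is_bilinear f) : {bilinear U -> V -> W} :=
  HB.pack f (bilinear_isBilinear.Build R U V W *:%R *:%R f (H.1, H.2)).

Declare Scope moncat_scope.
Reserved Notation "g ∘ f" (at level 45, right associativity).
Reserved Notation "f ⊗ g" (at level 40, left associativity).
Reserved Notation "X ⊠ Y" (at level 40, left associativity).

(* Not assumed strict: the associativity and unit isomorphisms are part of    *)
(* the data; [assl] reassociates to the left and [assr] to the right.         *)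
Record symMonCat := SymMonCat {
  Ob :> Type;
  Hom : Ob -> Ob -> zmodType;
  idm : forall X, Hom X X;
  comp : forall X Y Z, Hom Y Z -> Hom X Y -> Hom X Z
    where "g ∘ f" := (comp g f);
  tobj : Ob -> Ob -> Ob
    where "X ⊠ Y" := (tobj X Y);
  tmor : forall X X' Y Y', Hom X X' -> Hom Y Y' -> Hom (X ⊠ Y) (X' ⊠ Y')
    where "f ⊗ g" := (tmor f g);
  uobj : Ob;
  assl : forall X Y Z, Hom (X ⊠ (Y ⊠ Z)) ((X ⊠ Y) ⊠ Z);
  assr : forall X Y Z, Hom ((X ⊠ Y) ⊠ Z) (X ⊠ (Y ⊠ Z));
  lunit : forall X, Hom (uobj ⊠ X) X;
  lunitV : forall X, Hom X (uobj ⊠ X);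
  runit : forall X, Hom (X ⊠ uobj) X;
  runitV : forall X, Hom X (X ⊠ uobj);
  tau : forall X Y, Hom (X ⊠ Y) (Y ⊠ X);

  comp_idl : forall X Y (f : Hom X Y), idm Y ∘ f = f;
  comp_idr : forall X Y (f : Hom X Y), f ∘ idm X = f;
  comp_assoc : forall X Y Z T (f : Hom X Y) (g : Hom Y Z) (h : Hom Z T),
    h ∘ (g ∘ f) = (h ∘ g) ∘ f;
  comp_addl : forall X Y Z (f : Hom X Y) (g g' : Hom Y Z),
    (g + g') ∘ f = g ∘ f + g' ∘ f;
  comp_addr : forall X Y Z (f f' : Hom X Y) (g : Hom Y Z),
    g ∘ (f + f') = g ∘ f + g ∘ f';

  tmor_id : forall X Y, idm X ⊗ idm Y = idm (X ⊠ Y);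
  tmor_comp : forall X X' X'' Y Y' Y'' (f : Hom X X') (f' : Hom X' X'')
      (g : Hom Y Y') (g' : Hom Y' Y''),
    (f' ∘ f) ⊗ (g' ∘ g) = (f' ⊗ g') ∘ (f ⊗ g);
  tmor_addl : forall X X' Y Y' (f f' : Hom X X') (g : Hom Y Y'),
    (f + f') ⊗ g = f ⊗ g + f' ⊗ g;
  tmor_addr : forall X X' Y Y' (f : Hom X X') (g g' : Hom Y Y'),
    f ⊗ (g + g') = f ⊗ g + f ⊗ g';

  assl_nat : forall X X' Y Y' Z Z' (f : Hom X X') (g : Hom Y Y') (h : Hom Z Z'),
    assl X' Y' Z' ∘ (f ⊗ (g ⊗ h)) = ((f ⊗ g) ⊗ h) ∘ assl X Y Z;
  asslK : forall X Y Z, assr X Y Z ∘ assl X Y Z = idm (X ⊠ (Y ⊠ Z));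
  assrK : forall X Y Z, assl X Y Z ∘ assr X Y Z = idm ((X ⊠ Y) ⊠ Z);
  lunit_nat : forall X Y (f : Hom X Y), lunit Y ∘ (idm uobj ⊗ f) = f ∘ lunit X;
  lunitK : forall X, lunitV X ∘ lunit X = idm (uobj ⊠ X);
  lunitVK : forall X, lunit X ∘ lunitV X = idm X;
  runit_nat : forall X Y (f : Hom X Y), runit Y ∘ (f ⊗ idm uobj) = f ∘ runit X;
  runitK : forall X, runitV X ∘ runit X = idm (X ⊠ uobj);
  runitVK : forall X, runit X ∘ runitV X = idm X;
  pentagon : forall X Y Z T,
    assl (X ⊠ Y) Z T ∘ assl X Y (Z ⊠ T) =
    (assl X Y Z ⊗ idm T) ∘ assl X (Y ⊠ Z) T ∘ (idm X ⊗ assl Y Z T);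
  triangle : forall X Y,
    (runit X ⊗ idm Y) ∘ assl X uobj Y = idm X ⊗ lunit Y;

  tau_nat : forall X X' Y Y' (f : Hom X X') (g : Hom Y Y'),
    tau X' Y' ∘ (f ⊗ g) = (g ⊗ f) ∘ tau X Y;
  tauK : forall X Y, tau Y X ∘ tau X Y = idm (X ⊠ Y);
  hexagon : forall X Y Z,
    tau X (Y ⊠ Z) =
    assl Y Z X ∘ (idm Y ⊗ tau X Z) ∘ assr Y X Z ∘ (tau X Y ⊗ idm Z)
      ∘ assl X Y Z
}.

Arguments Hom {s} X Y.
Arguments idm {s} X.
Arguments comp {s X Y Z} g f.
Arguments tobj {s} X Y.
Arguments tmor {s X X' Y Y'} f g.
Arguments assl {s} X Y Z.
Arguments assr {s} X Y Z.
Arguments tau {s} X Y.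

Notation "g ∘ f" := (comp g f) : moncat_scope.
Notation "f ⊗ g" := (tmor f g) : moncat_scope.
Notation "X ⊠ Y" := (tobj X Y) : moncat_scope.
Local Open Scope moncat_scope.

Record cartierCat := CartierCat {
  cc_base :> symMonCat;
  eta : forall X Y : cc_base, Hom (X ⊠ Y) (X ⊠ Y);
  eta_nat : forall (X X' Y Y' : cc_base) (f : Hom X X') (g : Hom Y Y'),
    eta X' Y' ∘ (f ⊗ g) = (f ⊗ g) ∘ eta X Y;
  eta_tobj : forall X Y Z : cc_base,
    eta X (Y ⊠ Z) =
      assr X Y Z ∘ (eta X Y ⊗ idm Z) ∘ assl X Y Z
      + assr X Y Z ∘ (tau Y X ⊗ idm Z) ∘ assl Y X Z ∘ (idm Y ⊗ eta X Z)
          ∘ assr Y X Z ∘ (tau X Y ⊗ idm Z) ∘ assl X Y Z;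
  eta_tau : forall X Y : cc_base, eta Y X ∘ tau X Y = tau X Y ∘ eta X Y
}.

Arguments eta {c} X Y.

Section Zero.
Variable C : symMonCat.

Lemma comp0m (X Y Z : C) (f : Hom X Y) : (0 : Hom Y Z) ∘ f = 0.
Proof. by apply: (addrI (0 ∘ f)); rewrite -comp_addl !addr0. Qed.

Lemma compm0 (X Y Z : C) (f : Hom Y Z) : f ∘ (0 : Hom X Y) = 0.
Proof. by apply: (addrI (f ∘ 0)); rewrite -comp_addr !addr0. Qed.

Lemma tmor0m (X X' Y Y' : C) (g : Hom Y Y') : (0 : Hom X X') ⊗ g = 0.
Proof. by apply: (addrI (0 ⊗ g)); rewrite -tmor_addl !addr0. Qed.

Lemma tmorm0 (X X' Y Y' : C) (f : Hom X X') : f ⊗ (0 : Hom Y Y') = 0.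
Proof. by apply: (addrI (f ⊗ 0)); rewrite -tmor_addr !addr0. Qed.

Program Definition zeroCartier : cartierCat := @CartierCat C (fun X Y => 0) _ _ _.
Next Obligation. by rewrite comp0m compm0. Qed.
Next Obligation. by rewrite !(tmor0m, tmorm0, comp0m, compm0) addr0. Qed.
Next Obligation. by rewrite comp0m compm0. Qed.

End Zero.

Section Lie.
Variable C : symMonCat.

Section LieStructure.
Variables (g : C) (beta : Hom (g ⊠ g) g) (delta : Hom g (g ⊠ g)).

Let id := idm g.
Let t := tau g g.
Let id2 := idm (g ⊠ g).

Definition is_lie_algebra : Prop :=
  beta ∘ (id2 + t) = 0 /\
  beta ∘ (beta ⊗ id) =
    beta ∘ (id ⊗ beta) ∘ assr g g g ∘ (idm ((g ⊠ g) ⊠ g) - t ⊗ id).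

Definition is_lie_coalgebra : Prop :=
  (id2 + t) ∘ delta = 0 /\
  (delta ⊗ id) ∘ delta =
    (idm ((g ⊠ g) ⊠ g) - t ⊗ id) ∘ assl g g g ∘ (id ⊗ delta) ∘ delta.

(* [e] is the component at (g, g) of the infinitesimal braiding. *)
Definition is_lie_bialgebra_for (e : Hom (g ⊠ g) (g ⊠ g)) : Prop :=
  [/\ is_lie_algebra, is_lie_coalgebra &
      delta ∘ beta =
        (id2 - t) ∘ (beta ⊗ id) ∘ assl g g g ∘ (id ⊗ t) ∘ assr g g g
          ∘ (delta ⊗ id) ∘ (id2 - t)
        + (t - id2) ∘ e].

End LieStructure.
End Lie.

Record lieBialgebra (C : cartierCat) := LieBialgebra {
  lb_obj :> C;
  lb_bracket : Hom (lb_obj ⊠ lb_obj) lb_obj;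
  lb_cobracket : Hom lb_obj (lb_obj ⊠ lb_obj);
  lb_axiom : is_lie_bialgebra_for lb_bracket lb_cobracket (eta lb_obj lb_obj)
}.

Lemma zero_lie_bialgebra (C : symMonCat) (X : C) :
  @is_lie_bialgebra_for (zeroCartier C) X 0 0 (@eta (zeroCartier C) X X).
Proof.
by split; [split|split|]; rewrite !(tmor0m, tmorm0, comp0m, compm0) ?addr0.
Qed.

Definition zeroLieBialgebra (C : symMonCat) (X : C) :
  lieBialgebra (zeroCartier C) := LieBialgebra (zero_lie_bialgebra X).

Section Crossed.
Variables (C : cartierCat) (f : lieBialgebra C).

Definition is_crossed_module (V : C) (alpha : Hom (f ⊠ V) V)
    (lambda : Hom V (f ⊠ V)) : Prop :=
  [/\ alpha ∘ (lb_bracket f ⊗ idm V) =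
        alpha ∘ (idm f ⊗ alpha) ∘ assr f f V
          ∘ (idm ((f ⊠ f) ⊠ V) - tau f f ⊗ idm V),
      (lb_cobracket f ⊗ idm V) ∘ lambda =
        (idm ((f ⊠ f) ⊠ V) - tau f f ⊗ idm V)
          ∘ assl f f V ∘ (idm f ⊗ lambda) ∘ lambda
    & lambda ∘ alpha =
        (lb_bracket f ⊗ idm V) ∘ assl f f V ∘ (idm f ⊗ lambda)
        + (idm f ⊗ alpha) ∘ assr f f V ∘ (tau f f ⊗ idm V) ∘ assl f f V
            ∘ (idm f ⊗ lambda)
        + (idm f ⊗ alpha) ∘ assr f f V ∘ (lb_cobracket f ⊗ idm V)
        - eta f V].

Record crossedModule := CrossedModule {
  cm_obj :> C;
  cm_act : Hom (f ⊠ cm_obj) cm_obj;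
  cm_coact : Hom cm_obj (f ⊠ cm_obj);
  cm_axiom : is_crossed_module cm_act cm_coact
}.

Definition tens_act (V W : crossedModule) : Hom (f ⊠ (V ⊠ W)) (V ⊠ W) :=
  (cm_act V ⊗ idm W) ∘ assl f V W
  + (idm V ⊗ cm_act W) ∘ assr V f W ∘ (tau f V ⊗ idm W) ∘ assl f V W.

Definition tens_coact (V W : crossedModule) : Hom (V ⊠ W) (f ⊠ (V ⊠ W)) :=
  assr f V W ∘ (cm_coact V ⊗ idm W)
  + assr f V W ∘ (tau V f ⊗ idm W) ∘ assl V f W ∘ (idm V ⊗ cm_coact W).

Definition zeta (V W : crossedModule) : Hom (V ⊠ W) (W ⊠ V) :=
  (cm_act W ⊗ idm V) ∘ assl f W V ∘ (idm f ⊗ tau V W) ∘ assr f V W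
    ∘ (cm_coact V ⊗ idm W).

Definition eta_hat (V W : crossedModule) : Hom (V ⊠ W) (V ⊠ W) :=
  zeta W V ∘ tau V W + tau W V ∘ zeta V W + eta V W.

(* Composition, tensor product and symmetry of crossed modules are those of   *)
(* C; the bracket and the cobracket must moreover be morphisms of crossed     *)
(* modules, for the tensor product structure on V ⊠ V.                        *)
Definition is_crossed_lie_bialgebra (V : crossedModule)
    (beta : Hom (V ⊠ V) V) (delta : Hom V (V ⊠ V)) : Prop :=
  [/\ beta ∘ tens_act V V = cm_act V ∘ (idm f ⊗ beta),
      (idm f ⊗ beta) ∘ tens_coact V V = cm_coact V ∘ beta,
      delta ∘ cm_act V = tens_act V V ∘ (idm f ⊗ delta),
      (idm f ⊗ delta) ∘ cm_coact V = tens_coact V V ∘ delta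
    & is_lie_bialgebra_for beta delta (eta_hat V V)].

End Crossed.

Section Tensor.
Variables (k : fieldType) (V W : lmodType k).

(* V ⊗ W is the quotient of the formal sums of pairs (v, w) by the relation   *)
(* identifying two sums on which all bilinear maps agree; [liftE] and         *)
(* [tens_ext] are its universal property.                                     *)
Definition tens_rel (s t : seq (V * W)) : bool :=
  `[< forall (U : lmodType k) (f : {bilinear V -> W -> U}),
      \sum_(p <- s) f p.1 p.2 = \sum_(p <- t) f p.1 p.2 >].

Lemma tens_rel_refl : reflexive tens_rel.
Proof. by move=> s; apply/asboolP. Qed.

Lemma tens_rel_sym : symmetric tens_rel.
Proof. by move=> s t; apply/asboolP/asboolP => H U f; rewrite H. Qed.

Lemma tens_rel_trans : transitive tens_rel.
Proof.
move=> t s u /asboolP Hst /asboolP Htu; apply/asboolP => U f.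
by rewrite Hst Htu.
Qed.

Canonical tens_rel_equiv :=
  EquivRel tens_rel tens_rel_refl tens_rel_sym tens_rel_trans.

Definition tensor : Type := {eq_quot tens_rel}.

HB.instance Definition _ := Choice.on tensor.
HB.instance Definition _ := EqQuotient.on tensor.

Lemma tensP (s t : seq (V * W)) :
  (forall (U : lmodType k) (f : {bilinear V -> W -> U}),
      \sum_(p <- s) f p.1 p.2 = \sum_(p <- t) f p.1 p.2) <->
  \pi_tensor s = \pi_tensor t.
Proof.
split=> [H|/eqmodP/asboolP //]; by apply/eqmodP/asboolP.
Qed.

Lemma sum_repr (U : lmodType k) (f : {bilinear V -> W -> U}) s :
  \sum_(p <- repr (\pi_tensor s)) f p.1 p.2 = \sum_(p <- s) f p.1 p.2.
Proof. by have /tensP := reprK (\pi_tensor s); apply. Qed.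

Lemma tensW (P : tensor -> Prop) :
  (forall s, P (\pi_tensor s)) -> forall x, P x.
Proof. by move=> H x; rewrite -[x]reprK; apply: H. Qed.

Definition tens_zero : tensor := \pi_tensor [::].
Definition tens_add (x y : tensor) : tensor := \pi_tensor (repr x ++ repr y).
Definition tens_scale (c : k) (x : tensor) : tensor :=
  \pi_tensor [seq (c *: p.1, p.2) | p <- repr x].

Lemma tens_addE s t : tens_add (\pi_tensor s) (\pi_tensor t) = \pi_tensor (s ++ t).
Proof. by apply/tensP => U f; rewrite !big_cat /= !sum_repr. Qed.

Lemma tens_scaleE c s :
  tens_scale c (\pi_tensor s) = \pi_tensor [seq (c *: p.1, p.2) | p <- s].
Proof.
apply/tensP => U f; rewrite !big_map.
have E t : \sum_(j <- t) f (c *: j.1) j.2 = c *: \sum_(j <- t) f j.1 j.2.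
  by rewrite scaler_sumr; apply: eq_bigr => p _; rewrite linearZl_LR.
by rewrite /= !E sum_repr.
Qed.

Fact tens_addA : associative tens_add.
Proof.
move=> x y z; elim/tensW: x => x; elim/tensW: y => y; elim/tensW: z => z.
by rewrite !tens_addE catA.
Qed.

Fact tens_addC : commutative tens_add.
Proof.
move=> x y; elim/tensW: x => x; elim/tensW: y => y; rewrite !tens_addE.
by apply/tensP => U f; rewrite !big_cat /= addrC.
Qed.

Fact tens_add0 : left_id tens_zero tens_add.
Proof. by move=> x; elim/tensW: x => x; rewrite tens_addE. Qed.

Fact tens_addN : left_inverse tens_zero (tens_scale (-1)) tens_add.
Proof.
move=> x; elim/tensW: x => x; rewrite tens_scaleE tens_addE; apply/tensP => U f.
rewrite big_cat big_map big_nil /= -big_split big1 //= => p _.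
by rewrite linearZl_LR scaleN1r addNr.
Qed.

HB.instance Definition _ :=
  GRing.isZmodule.Build tensor tens_addA tens_addC tens_add0 tens_addN.

Lemma tensD s t : \pi_tensor s + \pi_tensor t = \pi_tensor (s ++ t).
Proof. exact: tens_addE. Qed.

Fact tens_scaleA a b v : tens_scale a (tens_scale b v) = tens_scale (a * b) v.
Proof.
elim/tensW: v => x; rewrite !tens_scaleE; apply/tensP => U f.
by rewrite !big_map; apply: eq_bigr => p _ /=; rewrite scalerA.
Qed.

Fact tens_scale1 : left_id 1 tens_scale.
Proof.
move=> x; elim/tensW: x => x; rewrite tens_scaleE; apply/tensP => U f.
by rewrite big_map; apply: eq_bigr => p _ /=; rewrite scale1r.
Qed.

Fact tens_scaleDr : right_distributive tens_scale +%R.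
Proof.
move=> c x y; elim/tensW: x => x; elim/tensW: y => y.
by rewrite tensD !tens_scaleE tensD map_cat.
Qed.

Fact tens_scaleDl v : {morph tens_scale^~ v : a b / a + b}.
Proof.
move=> a b; elim/tensW: v => x; rewrite !tens_scaleE tensD.
apply/tensP => U f; rewrite big_cat !big_map /= -big_split /=. 
by apply: eq_bigr => p _ /=; rewrite !linearZl_LR scalerDl.
Qed.

HB.instance Definition _ := GRing.Zmodule_isLmodule.Build k tensor
  tens_scaleA tens_scale1 tens_scaleDr tens_scaleDl.

Definition pure (v : V) (w : W) : tensor := \pi_tensor [:: (v, w)].

Fact pure_bilinear : is_bilinear pure.
Proof.
split=> [w a v v'|v a w w'] /=; apply/esym.
- rewrite /pure [_ *: _]tens_scaleE tensD; apply/tensP => U f /=.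
  by rewrite !big_cons !big_nil !addr0 linearDl linearZl_LR.
- rewrite /pure [_ *: _]tens_scaleE tensD; apply/tensP => U f /=.
  by rewrite !big_cons !big_nil !addr0 linearDr linearZl_LR linearZr_LR.
Qed.

HB.instance Definition _ :=
  bilinear_isBilinear.Build k V W tensor *:%R *:%R pure
    (pure_bilinear.1, pure_bilinear.2).

Section Lift.
Variables (U : lmodType k) (f : {bilinear V -> W -> U}).

Definition lift (x : tensor) : U := \sum_(p <- repr x) f p.1 p.2.

Fact lift_linear : linear lift.
Proof.
move=> a x y; elim/tensW: x => x; elim/tensW: y => y.
rewrite [a *: _]tens_scaleE tensD /lift !sum_repr big_cat big_map.
rewrite scaler_sumr; congr (_ + _); apply: eq_bigr => p _.
by rewrite linearZl_LR.
Qed.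

HB.instance Definition _ := GRing.isLinear.Build k tensor U *:%R lift lift_linear.

Lemma liftE v w : lift (pure v w) = f v w.
Proof. by rewrite /lift sum_repr big_seq1. Qed.

End Lift.

Lemma tens_ind (P : tensor -> Prop) :
  P 0 -> (forall x y, P x -> P y -> P (x + y)) -> (forall v w, P (pure v w)) ->
  forall x, P x.
Proof.
move=> P0 PD Pp; apply: tensW => s.
suff H : forall t : seq (V * W), P (\pi_tensor t) by apply: H.
elim=> [|[v w] t IH]; first exact: P0.
rewrite -[(v, w) :: t]cat1s -tensD; apply: PD IH; exact: Pp.
Qed.

Lemma tens_ext (U : lmodType k) (f g : {linear tensor -> U}) :
  (forall v w, f (pure v w) = g (pure v w)) -> f =1 g.
Proof.
move=> H; apply: tens_ind => [|x y fx fy|//]; first by rewrite !linear0.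
by rewrite !linearD fx fy.
Qed.

End Tensor.

Arguments lift : simpl never.
Arguments pure : simpl never.

(* The abelian group G is written additively: its neutral element is 0, and   *)
(* the power g^i is g *~ i. Values of a bicharacter are nonzero by            *)
(* [bichar_anti].                                                             *)
Record bicharacter (G : zmodType) (k : fieldType) := Bicharacter {
  bichar :> G -> G -> k;
  bichar_anti : forall a b, bichar a b * bichar b a = 1;
  bichar_addl : forall a b c, bichar (a + b) c = bichar a c * bichar b c
}.

Section ColorSpaces.
Variables (k : fieldType) (G : zmodType).

(* A G-graded vector space V: the grading is given by the projections [cpr a] *)
(* onto the components V_a = [set v | homog a v], and [cprK], [cpr_dec] say   *)
(* that V is the direct sum of these components.                              *)
Record colorSpace := ColorSpace {
  csort :> lmodType k;
  cpr : G -> {linear csort -> csort};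
  cprK : forall a b v, cpr a (cpr b v) = if a == b then cpr b v else 0;
  cpr_dec : forall v, exists2 s : seq G, uniq s & v = \sum_(a <- s) cpr a v
}.

Definition homog (V : colorSpace) (a : G) (v : V) : Prop := cpr V a v = v.

Lemma homog_pr (V : colorSpace) a (v : V) : homog a (cpr V a v).
Proof. by rewrite /homog cprK eqxx. Qed.

Lemma homog_prE (V : colorSpace) a b (v : V) :
  homog b v -> cpr V a v = if a == b then v else 0.
Proof. by move=> h; rewrite -[in LHS]h cprK h. Qed.

Lemma homogD (V : colorSpace) a (v w : V) :
  homog a v -> homog a w -> homog a (v + w).
Proof. by rewrite /homog linearD => -> ->. Qed.

Lemma homogZ (V : colorSpace) a c (v : V) : homog a v -> homog a (c *: v).
Proof. by rewrite /homog linearZ /= => ->. Qed.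

Lemma homog0 (V : colorSpace) a : homog a (0 : V).
Proof. by rewrite /homog linear0. Qed.

Lemma homog_sum (V : colorSpace) a I (r : seq I) (F : I -> V) :
  (forall i, homog a (F i)) -> homog a (\sum_(i <- r) F i).
Proof.
by move=> H; apply: big_ind => //; [exact: homog0|exact: homogD].
Qed.

Lemma homog_ind (V : colorSpace) (P : V -> Prop) :
  P 0 -> (forall x y, P x -> P y -> P (x + y)) ->
  (forall a v, homog a v -> P v) -> forall v, P v.
Proof.
move=> P0 PD Ph v; have [s _ ->] := cpr_dec v.
by apply: big_ind => // a _; apply: (Ph a); apply: homog_pr.
Qed.

Lemma homog_ext (V : colorSpace) (U : lmodType k) (f g : {linear V -> U}) :
  (forall a v, homog a v -> f v = g v) -> f =1 g.
Proof.
move=> H; apply: homog_ind => [|x y fx fy|a v]; [by rewrite !linear0| |exact: H].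
by rewrite !linearD fx fy.
Qed.

Definition supp (V : colorSpace) (v : V) : seq G := s2val (cid2 (cpr_dec v)).

Lemma supp_uniq (V : colorSpace) (v : V) : uniq (supp v).
Proof. by rewrite /supp; case: cid2. Qed.

Lemma suppE (V : colorSpace) (v : V) : \sum_(a <- supp v) cpr V a v = v.
Proof. by rewrite /supp; case: cid2. Qed.

Lemma supp_out (V : colorSpace) (v : V) a : a \notin supp v -> cpr V a v = 0.
Proof.
move=> Ha; rewrite -[v in LHS]suppE linear_sum big1_seq //= => b Hb.
by rewrite cprK; case: eqP => // ab; rewrite ab Hb in Ha.
Qed.

Lemma big_supp (U : nmodType) (s t : seq G) (F : G -> U) :
  uniq s -> uniq t -> (forall a, a \notin s -> F a = 0) ->
  (forall a, a \notin t -> F a = 0) -> \sum_(a <- s) F a = \sum_(a <- t) F a.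
Proof.
move=> us ut Fs Ft.
have E (r q : seq G) : (forall a, a \notin q -> F a = 0) ->
    \sum_(a <- r) F a = \sum_(a <- [seq a <- r | a \in q]) F a.
  move=> Fq; rewrite big_filter [LHS](bigID (mem q)) /=.
  by rewrite [X in _ + X]big1 ?addr0 // => a; apply: Fq.
rewrite (E s t Ft) (E t s Fs); apply: perm_big; apply: uniq_perm.
- exact: filter_uniq.
- exact: filter_uniq.
- by move=> a; rewrite !mem_filter andbC.
Qed.

(* [gsum H v] is the sum of the H a (cpr a v) over all degrees a in G.        *)
Section GradedSum.
Variables (V : colorSpace) (U : lmodType k) (H : G -> {linear V -> U}).

Definition gsum (v : V) : U := \sum_(a <- supp v) H a (cpr V a v).

Lemma gsumE (v : V) s : uniq s -> (forall a, a \notin s -> cpr V a v = 0) ->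
  gsum v = \sum_(a <- s) H a (cpr V a v).
Proof.
move=> us Hs; apply: big_supp => //; first exact: supp_uniq.
- by move=> a Ha; rewrite supp_out // linear0.
- by move=> a Ha; rewrite Hs // linear0.
Qed.

Fact gsum_linear : linear gsum.
Proof.
move=> c v w; pose s := undup (supp v ++ supp w).
have us : uniq s by apply: undup_uniq.
have sv a : a \notin s -> cpr V a v = 0.
  by rewrite mem_undup mem_cat negb_or => /andP[/supp_out].
have sw a : a \notin s -> cpr V a w = 0.
  by rewrite mem_undup mem_cat negb_or => /andP[_ /supp_out].
rewrite (gsumE us sv) (gsumE us sw) (@gsumE _ s) //.
  rewrite scaler_sumr -big_split; apply: eq_bigr => a _ /=.
  by rewrite !linearP.
by move=> a Ha; rewrite linearP sv // sw // scaler0 addr0.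
Qed.

HB.instance Definition _ := GRing.isLinear.Build k V U *:%R gsum gsum_linear.

Lemma gsum_homog a (v : V) : homog a v -> gsum v = H a v.
Proof.
move=> Hv; rewrite (@gsumE _ [:: a]) //; first by rewrite big_seq1 Hv.
by move=> b; rewrite inE (homog_prE _ Hv) => /negPf ->.
Qed.

End GradedSum.

Record colorHom (V W : colorSpace) := ColorHom {
  chom_fun :> V -> W;
  chom_linear : linear chom_fun;
  chom_homog : forall a v, homog a v -> homog a (chom_fun v)
}.

HB.instance Definition _ (V W : colorSpace) (f : colorHom V W) :=
  GRing.isLinear.Build k V W *:%R f (@chom_linear V W f).

Lemma chom_pr (V W : colorSpace) (f : colorHom V W) a v :
  f (cpr V a v) = cpr W a (f v).
Proof.
elim/homog_ind: v => [|x y Hx Hy|b v Hv]; first by rewrite !linear0.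
  by rewrite !linearD /= Hx Hy.
rewrite (homog_prE _ Hv) (homog_prE _ (chom_homog f Hv)).
by case: eqP; rewrite // linear0.
Qed.

Lemma chom_eqP (V W : colorSpace) (f g : colorHom V W) : f =1 g -> f = g.
Proof.
case: f g => [f lf hf] [g lg hg] /= /funext fg; case: _ / fg lg hg => lg hg.
by rewrite (Prop_irrelevance lf lg) (Prop_irrelevance hf hg).
Qed.

End ColorSpaces.

Arguments gsum : simpl never.

Section ColorHom.
Variables (k : fieldType) (G : zmodType) (V W : colorSpace k G).

HB.instance Definition _ := gen_eqMixin (colorHom V W).
HB.instance Definition _ := gen_choiceMixin (colorHom V W).

Program Definition chom_zero : colorHom V W := @ColorHom k G V W (fun=> 0) _ _.
Next Obligation. by move=> a v w; rewrite scaler0 addr0. Qed.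
Next Obligation. exact: homog0. Qed.

Program Definition chom_opp (f : colorHom V W) : colorHom V W :=
  @ColorHom k G V W (fun v => - f v) _ _.
Next Obligation. by move=> a v w; rewrite linearP opprD scalerN. Qed.
Next Obligation. by rewrite -scaleN1r; apply/homogZ/chom_homog. Qed.

Program Definition chom_add (f g : colorHom V W) : colorHom V W :=
  @ColorHom k G V W (fun v => f v + g v) _ _.
Next Obligation. by move=> a v w; rewrite !linearP scalerDr addrACA. Qed.
Next Obligation. by apply: homogD; apply: chom_homog. Qed.

Fact chom_addA : associative chom_add.
Proof. by move=> f g h; apply: chom_eqP => v /=; rewrite addrA. Qed.
Fact chom_addC : commutative chom_add.
Proof. by move=> f g; apply: chom_eqP => v /=; rewrite addrC. Qed.
Fact chom_add0 : left_id chom_zero chom_add.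
Proof. by move=> f; apply: chom_eqP => v /=; rewrite add0r. Qed.
Fact chom_addN : left_inverse chom_zero chom_opp chom_add.
Proof. by move=> f; apply: chom_eqP => v /=; rewrite addNr. Qed.

HB.instance Definition _ := GRing.isZmodule.Build (colorHom V W)
  chom_addA chom_addC chom_add0 chom_addN.

Lemma chom_addE (f g : colorHom V W) v : (f + g) v = f v + g v.
Proof. by []. Qed.
Lemma chom_oppE (f : colorHom V W) v : (- f) v = - f v.
Proof. by []. Qed.
Lemma chom_zeroE v : (0 : colorHom V W) v = 0.
Proof. by []. Qed.

End ColorHom.

Section ColorCat.
Variables (k : fieldType) (G : zmodType).
Implicit Types V W X Y Z : colorSpace k G.

Definition chom_id V : colorHom V V :=
  @ColorHom k G V V idfun (fun a v w => erefl) (fun a v h => h).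

Program Definition chom_comp V W X (g : colorHom W X) (f : colorHom V W) :
  colorHom V X := @ColorHom k G V X (fun v => g (f v)) _ _.
Next Obligation. by move=> c v w; rewrite !linearP. Qed.
Next Obligation. by do 2! apply: chom_homog. Qed.

(* The component of degree c of V ⊗ W is the sum of the V_a ⊗ W_(c - a).      *)
Section TensorGrading.
Variables V W : colorSpace k G.

Fact pure_r_linear (w : W) : linear (fun v : V => pure v w).
Proof. by move=> c v v'; rewrite linearPl. Qed.
Fact pure_l_linear (v : V) : linear (fun w : W => pure v w).
Proof. by move=> c w w'; rewrite linearPr. Qed.

Definition tpr_fun (c : G) (v : V) (w : W) : tensor V W :=
  gsum (fun a => mk_linear (pure_r_linear (cpr W (c - a) w))) v.

Fact tpr_bilinear c : is_bilinear (tpr_fun c).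
Proof.
split=> [w|v] a x y; first exact: linearP.
rewrite /tpr_fun /= /gsum scaler_sumr -big_split; apply: eq_bigr => b _ /=.
by rewrite linearP linearPr.
Qed.

Definition tpr (c : G) : tensor V W -> tensor V W :=
  lift (mk_bilinear (tpr_bilinear c)).

HB.instance Definition _ c := GRing.Linear.on (tpr c).

Lemma tprE c a b (v : V) (w : W) : homog a v -> homog b w ->
  tpr c (pure v w) = if c == a + b then pure v w else 0.
Proof.
move=> hv hw; rewrite /tpr liftE -[LHS]/(tpr_fun c v w) /tpr_fun (gsum_homog _ hv) /=.
rewrite (homog_prE _ hw).
by rewrite subr_eq addrC; case: eqP => // _; rewrite linear0r.
Qed.

Lemma tens_homog_ind (P : tensor V W -> Prop) :
  P 0 -> (forall x y, P x -> P y -> P (x + y)) ->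
  (forall a b v w, homog a v -> homog b w -> P (pure v w)) -> forall x, P x.
Proof.
move=> P0 PD Ph; apply: tens_ind => // v w.
elim/homog_ind: v => [|v v' Pv Pv'|a v hv]; first by rewrite linear0l.
  by rewrite linearDl; apply: PD.
elim/homog_ind: w => [|w w' Pw Pw'|b w hw]; first by rewrite linear0r.
  by rewrite linearDr; apply: PD.
exact: Ph hv hw.
Qed.

Lemma tens_homog_ext (U : lmodType k) (f g : {linear tensor V W -> U}) :
  (forall a b v w, homog a v -> homog b w -> f (pure v w) = g (pure v w)) ->
  f =1 g.
Proof.
move=> H; apply: tens_homog_ind => [|x y fx fy|a b v w hv hw].
- by rewrite !linear0.
- by rewrite !linearD fx fy.
- exact: H hv hw.
Qed.

Fact tprK a b t : tpr a (tpr b t) = if a == b then tpr b t else 0.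
Proof.
elim/tens_homog_ind: t => [|x y Hx Hy|c d v w hv hw].
- by rewrite !linear0; case: eqP.
- by rewrite !linearD /= Hx Hy; case: eqP => // _; rewrite addr0.
- rewrite !(tprE b hv hw); case: (b =P c + d) => [->|_].
    by rewrite (tprE a hv hw).
  by rewrite linear0; case: eqP.
Qed.

Fact tpr_dec t : exists2 s : seq G, uniq s & t = \sum_(a <- s) tpr a t.
Proof.
elim/tens_homog_ind: t => [|x y [s us Es] [t ut Et]|c d v w hv hw].
- by exists [::]; rewrite ?big_nil.
- pose q := undup (s ++ t); have uq : uniq q by apply: undup_uniq.
  exists q => //; under eq_bigr do rewrite linearD.
  have out z r : z = \sum_(a <- r) tpr a z -> forall a, a \notin r -> tpr a z = 0.
    move=> Ez a Ha; rewrite Ez linear_sum big1_seq // => b /andP[_ Hb].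
    by rewrite /= tprK; case: eqP => // ab; rewrite ab Hb in Ha.
  rewrite big_split /=; congr (_ + _).
    rewrite [LHS]Es; apply: big_supp => //; first exact: out.
    by move=> a; rewrite mem_undup mem_cat negb_or => /andP[/(out x s Es)].
  rewrite [LHS]Et; apply: big_supp => //; first exact: out.
  by move=> a; rewrite mem_undup mem_cat negb_or => /andP[_ /(out y t Et)].
- by exists [:: c + d] => //; rewrite big_seq1 (tprE _ hv hw) eqxx.
Qed.

Definition ctens : colorSpace k G := @ColorSpace k G (tensor V W) tpr tprK tpr_dec.

Lemma homog_pure a b (v : V) (w : W) :
  homog a v -> homog b w -> homog (V := ctens) (a + b) (pure v w).
Proof. by move=> hv hw; rewrite /homog /= (tprE _ hv hw) eqxx. Qed.

End TensorGrading.

Section HomLift.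
Variables (V W X : colorSpace k G) (f : V -> W -> X).
Hypothesis bf : is_bilinear f.
Hypothesis hf : forall a b v w, homog a v -> homog b w -> homog (a + b) (f v w).

Fact chom_lift_homog c (t : ctens V W) :
  homog c t -> homog c (lift (mk_bilinear bf) t).
Proof.
move<-; elim/tens_homog_ind: t => [|x y Hx Hy|a b v w hv hw].
- by rewrite !linear0; apply: homog0.
- by rewrite !linearD; apply: homogD.
- rewrite [cpr _ _ _](tprE _ hv hw); case: eqP => [->|_].
    by rewrite liftE; apply: hf.
  by rewrite linear0; apply: homog0.
Qed.

Definition chom_lift : colorHom (ctens V W) X :=
  @ColorHom k G (ctens V W) X (lift (mk_bilinear bf))
    (lift_linear (mk_bilinear bf)) chom_lift_homog.

Lemma chom_liftE v w : chom_lift (pure v w) = f v w.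
Proof. exact: liftE. Qed.

End HomLift.

Section TensorMap.
Variables (V V' W W' : colorSpace k G) (f : colorHom V V') (g : colorHom W W').

Fact tmap_bilinear : is_bilinear (fun v w => pure (f v) (g w)).
Proof. by split=> [w|v] a x y /=; rewrite linearP (linearPl, linearPr). Qed.

Fact tmap_homog a b v w : homog a v -> homog b w ->
  homog (V := ctens V' W') (a + b) (pure (f v) (g w)).
Proof. by move=> hv hw; apply: homog_pure; apply: chom_homog. Qed.

Definition chom_tens : colorHom (ctens V W) (ctens V' W') :=
  chom_lift (X := ctens V' W') tmap_bilinear tmap_homog.

Lemma chom_tensE v w : chom_tens (pure v w) = pure (f v) (g w).
Proof. exact: chom_liftE. Qed.

End TensorMap.

Section Assoc.
Variables X Y Z : colorSpace k G.

Fact assl1_bilinear (x : X) :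
  is_bilinear
    (fun (y : Y) (z : Z) => pure (pure x y : ctens X Y) z).
Proof.
by split=> [z|y] a u v /=; [rewrite linearPr linearPl | rewrite linearPr].
Qed.

Definition assl_fun (x : X) (t : ctens Y Z) : ctens (ctens X Y) Z :=
  lift (mk_bilinear (assl1_bilinear x)) t.

Lemma assl_funE x y z : assl_fun x (pure y z) = pure (pure x y : ctens X Y) z.
Proof. exact: liftE. Qed.

Lemma assl_fun0 x : assl_fun x 0 = 0.
Proof. exact: linear0. Qed.

Lemma assl_funD x s t : assl_fun x (s + t) = assl_fun x s + assl_fun x t.
Proof. exact: linearD. Qed.

Fact assl_bilinear : is_bilinear assl_fun.
Proof.
split=> [t|x] a u v; last exact: linearP.
elim/tens_ind: t => [|s t Hs Ht|y z].
- by rewrite !assl_fun0 addr0 [RHS]scaler0.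
- by rewrite !assl_funD Hs Ht scalerDr addrACA.
- by rewrite !assl_funE !linearPl.
Qed.

Fact assl_homog a b (x : X) (t : ctens Y Z) : homog a x -> homog b t ->
  homog (a + b) (assl_fun x t).
Proof.
move=> hx <-; elim/tens_homog_ind: t => [|s t Hs Ht|c d y z hy hz].
- by rewrite linear0 assl_fun0; apply: homog0.
- by rewrite linearD assl_funD; apply: homogD.
- rewrite [cpr _ _ _](tprE _ hy hz); case: eqP => [->|_].
    by rewrite assl_funE addrA; do 2! apply: homog_pure => //.
  by rewrite assl_fun0; apply: homog0.
Qed.

Definition chom_assl : colorHom (ctens X (ctens Y Z)) (ctens (ctens X Y) Z) :=
  chom_lift assl_bilinear assl_homog.

Lemma chom_asslE x y z :
  chom_assl (pure x (pure y z : ctens Y Z)) = pure (pure x y : ctens X Y) z.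
Proof. by rewrite chom_liftE assl_funE. Qed.

Fact assr1_bilinear (z : Z) :
  is_bilinear
    (fun (x : X) (y : Y) => pure x (pure y z : ctens Y Z)).
Proof.
by split=> [y|x] a u v /=; [rewrite linearPl | rewrite linearPl linearPr].
Qed.

Definition assr_fun (t : ctens X Y) (z : Z) : ctens X (ctens Y Z) :=
  lift (mk_bilinear (assr1_bilinear z)) t.

Lemma assr_funE x y z : assr_fun (pure x y) z = pure x (pure y z : ctens Y Z).
Proof. exact: liftE. Qed.

Lemma assr_fun0 z : assr_fun 0 z = 0.
Proof. exact: linear0. Qed.

Lemma assr_funD z s t : assr_fun (s + t) z = assr_fun s z + assr_fun t z.
Proof. exact: linearD. Qed.

Fact assr_bilinear : is_bilinear assr_fun.
Proof.
split=> [z|t] a u v; first exact: linearP.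
elim/tens_ind: t => [|s t Hs Ht|x y].
- by rewrite !assr_fun0 addr0 [RHS]scaler0.
- by rewrite !assr_funD Hs Ht scalerDr addrACA.
- by rewrite !assr_funE !linearPr.
Qed.

Fact assr_homog a b (t : ctens X Y) (z : Z) : homog a t -> homog b z ->
  homog (a + b) (assr_fun t z).
Proof.
move=> <- hz; elim/tens_homog_ind: t => [|s t Hs Ht|c d x y hx hy].
- by rewrite linear0 assr_fun0; apply: homog0.
- by rewrite linearD assr_funD; apply: homogD.
- rewrite [cpr _ _ _](tprE _ hx hy); case: eqP => [->|_].
    by rewrite assr_funE -addrA; do 2! apply: homog_pure => //.
  by rewrite assr_fun0; apply: homog0.
Qed.

Definition chom_assr : colorHom (ctens (ctens X Y) Z) (ctens X (ctens Y Z)) :=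
  chom_lift assr_bilinear assr_homog.

Lemma chom_assrE x y z :
  chom_assr (pure (pure x y : ctens X Y) z) = pure x (pure y z : ctens Y Z).
Proof. by rewrite chom_liftE assr_funE. Qed.

End Assoc.

Section Unit.

Definition unit_pr (a : G) : k^o -> k^o := fun c => if a == 0 then c else 0.

Fact unit_pr_linear a : linear (unit_pr a).
Proof.
by move=> c u v; rewrite /unit_pr; case: eqP => // _; rewrite scaler0 addr0.
Qed.

Fact unit_prK a b v :
  unit_pr a (unit_pr b v) = if a == b then unit_pr b v else 0.
Proof.
rewrite /unit_pr; have [->|ab] := eqVneq a b; first by case: eqP.
case: eqP => // a0; case: eqP => // b0; by rewrite a0 b0 eqxx in ab.
Qed.

Fact unit_pr_dec v : exists2 s : seq G, uniq s & v = \sum_(a <- s) unit_pr a v.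
Proof. by exists [:: 0] => //; rewrite big_seq1 /unit_pr eqxx. Qed.

Definition cunit : colorSpace k G :=
  @ColorSpace k G k^o (fun a => mk_linear (unit_pr_linear a)) unit_prK unit_pr_dec.

Lemma unit_homog a (c : cunit) : homog a c -> a = 0 \/ c = 0.
Proof.
by rewrite /homog /= /unit_pr; case: eqP => [|_ <-]; [left|right].
Qed.

Lemma homog1 : homog 0 (1 : cunit).
Proof. by rewrite /homog /= /unit_pr eqxx. Qed.

Variable V : colorSpace k G.

Fact lunit_bilinear : is_bilinear (fun (c : cunit) (v : V) => c *: v).
Proof.
split=> [v|c] a x y /=; first by rewrite scalerDl scalerA.
by rewrite scalerDr !scalerA mulrC.
Qed.

Fact lunit_homog a b (c : cunit) (v : V) :
  homog a c -> homog b v -> homog (a + b) (c *: v).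
Proof.
move=> /unit_homog[->|->] hv; first by rewrite add0r; apply: homogZ.
by rewrite scale0r; apply: homog0.
Qed.

Definition chom_lunit : colorHom (ctens cunit V) V :=
  chom_lift lunit_bilinear lunit_homog.

Lemma chom_lunitE (c : cunit) v : chom_lunit (pure c v) = c *: v.
Proof. exact: chom_liftE. Qed.

Fact runit_bilinear : is_bilinear (fun (v : V) (c : cunit) => c *: v).
Proof.
split=> [c|v] a x y /=; last by rewrite scalerDl scalerA.
by rewrite scalerDr !scalerA mulrC.
Qed.

Fact runit_homog a b (v : V) (c : cunit) :
  homog a v -> homog b c -> homog (a + b) (c *: v).
Proof.
move=> hv /unit_homog[->|->]; first by rewrite addr0; apply: homogZ.
by rewrite scale0r; apply: homog0.
Qed.

Definition chom_runit : colorHom (ctens V cunit) V :=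
  chom_lift runit_bilinear runit_homog.

Lemma chom_runitE v (c : cunit) : chom_runit (pure v c) = c *: v.
Proof. exact: chom_liftE. Qed.

Fact lunitV_linear : linear (fun v : V => pure (1 : cunit) v).
Proof. by move=> a u v; rewrite linearPr. Qed.

Fact lunitV_homog a (v : V) :
  homog a v -> homog (V := ctens cunit V) a (pure (1 : cunit) v).
Proof. by move=> hv; rewrite -[a]add0r; apply: homog_pure homog1 hv. Qed.

Definition chom_lunitV : colorHom V (ctens cunit V) :=
  @ColorHom k G V (ctens cunit V) _ lunitV_linear lunitV_homog.

Fact runitV_linear : linear (fun v : V => pure v (1 : cunit)).
Proof. by move=> a u v; rewrite linearPl. Qed.

Fact runitV_homog a (v : V) :
  homog a v -> homog (V := ctens V cunit) a (pure v (1 : cunit)).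
Proof. by move=> hv; rewrite -[a]addr0; apply: homog_pure hv homog1. Qed.

Definition chom_runitV : colorHom V (ctens V cunit) :=
  @ColorHom k G V (ctens V cunit) _ runitV_linear runitV_homog.

End Unit.

Section Symmetry.
Variables (chi : bicharacter G k) (V W : colorSpace k G).

Fact twist_linear (c : k) : linear (fun w : W => c *: w).
Proof. by move=> a u v; rewrite scalerDr !scalerA mulrC. Qed.

Definition twist (a : G) (w : W) : W :=
  gsum (fun b => mk_linear (twist_linear (chi a b))) w.

HB.instance Definition _ a :=
  GRing.isLinear.Build k W W *:%R (twist a) (gsum_linear _).

Lemma twistE a b w : homog b w -> twist a w = chi a b *: w.
Proof. by move=> hw; rewrite /twist (gsum_homog _ hw). Qed.

Definition tau_fun (v : V) (w : W) : ctens W V :=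
  gsum (fun a => mk_linear (pure_l_linear (V := W) (twist a w))) v.

Lemma tau_funE a b v w : homog a v -> homog b w ->
  tau_fun v w = chi a b *: pure w v.
Proof.
by move=> hv hw; rewrite /tau_fun (gsum_homog _ hv) /= (twistE _ hw) linearZl_LR.
Qed.

Fact tau_bilinear : is_bilinear tau_fun.
Proof.
split=> [w|v] a x y; first exact: linearP.
rewrite /tau_fun /= /gsum scaler_sumr -big_split; apply: eq_bigr => b _ /=.
by rewrite linearP linearPl.
Qed.

Fact tau_homog a b v w : homog a v -> homog b w -> homog (a + b) (tau_fun v w).
Proof.
move=> hv hw; rewrite (tau_funE hv hw) addrC.
exact/homogZ/homog_pure.
Qed.

Definition chom_tau : colorHom (ctens V W) (ctens W V) :=
  chom_lift tau_bilinear tau_homog.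

Lemma chom_tauE a b v w : homog a v -> homog b w ->
  chom_tau (pure v w) = chi a b *: pure w v.
Proof. by move=> hv hw; rewrite chom_liftE (tau_funE hv hw). Qed.

End Symmetry.

Lemma pureZl V W (c : k) (v : V) (w : W) : pure (c *: v) w = c *: pure v w.
Proof. by rewrite linearZl_LR. Qed.

Lemma pureZr V W (c : k) (v : V) (w : W) : pure v (c *: w) = c *: pure v w.
Proof. by rewrite linearZr_LR. Qed.

Lemma bichar_addr (chi : bicharacter G k) a b c :
  chi a (b + c) = chi a b * chi a c.
Proof.
have nz x y : chi x y != 0.
  apply/eqP => E; have /eqP := bichar_anti chi x y.
  by rewrite E mul0r eq_sym oner_eq0.
apply: (mulIf (nz (b + c) a)); rewrite bichar_anti bichar_addl.
by rewrite mulrACA !bichar_anti mulr1.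
Qed.

Lemma chom_ext2 V W X (f g : colorHom (ctens V W) X) :
  (forall a b v w, homog a v -> homog b w -> f (pure v w) = g (pure v w)) ->
  f = g.
Proof.
move=> H; apply: chom_eqP; apply: tens_homog_ind => [|x y fx fy|a b v w hv hw].
- by rewrite !linear0.
- by rewrite !linearD /= fx fy.
- exact: H hv hw.
Qed.

Lemma chom_ext3l X Y Z V (f g : colorHom (ctens (ctens X Y) Z) V) :
  (forall a b c x y z, homog a x -> homog b y -> homog c z ->
    f (pure (pure x y : ctens X Y) z) = g (pure (pure x y : ctens X Y) z)) ->
  f = g.
Proof.
move=> H; apply: chom_ext2 => d c t z _ hz.
elim/tens_homog_ind: t => [|s t Hs Ht|a b x y hx hy].
- by rewrite linear0l !linear0.
- by rewrite linearDl !linearD /= Hs Ht.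
- exact: H hx hy hz.
Qed.

Lemma chom_ext3r X Y Z V (f g : colorHom (ctens X (ctens Y Z)) V) :
  (forall a b c x y z, homog a x -> homog b y -> homog c z ->
    f (pure x (pure y z : ctens Y Z)) = g (pure x (pure y z : ctens Y Z))) ->
  f = g.
Proof.
move=> H; apply: chom_ext2 => a d x t hx _.
elim/tens_homog_ind: t => [|s t Hs Ht|b c y z hy hz].
- by rewrite linear0r !linear0.
- by rewrite linearDr !linearD /= Hs Ht.
- exact: H hx hy hz.
Qed.

Lemma chom_ext4r X Y Z T V (f g : colorHom (ctens X (ctens Y (ctens Z T))) V) :
  (forall x y z t,
    f (pure x (pure y (pure z t : ctens Z T) : ctens Y (ctens Z T))) =
    g (pure x (pure y (pure z t : ctens Z T) : ctens Y (ctens Z T)))) ->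
  f = g.
Proof.
move=> H; apply: chom_ext3r => a b c x y u _ _ _.
elim/tens_ind: u => [|s u Hs Hu|z t].
- by rewrite !linear0r !linear0.
- by rewrite !linearDr !linearD /= Hs Hu.
- exact: H.
Qed.

Lemma chomZ V W (f : colorHom V W) c v : f (c *: v) = c *: f v.
Proof. exact: linearZ. Qed.

Lemma chom_compE V W X (g : colorHom W X) (f : colorHom V W) v :
  chom_comp g f v = g (f v).
Proof. by []. Qed.

Lemma chom_idE V (v : V) : chom_id V v = v.
Proof. by []. Qed.

Definition chomE := (chom_compE, chom_idE, chom_tensE, chom_asslE, chom_assrE,
  chom_lunitE, chom_runitE).

Fact ctens_id V W : chom_tens (chom_id V) (chom_id W) = chom_id (ctens V W).
Proof. by apply: chom_ext2 => a b v w _ _; rewrite !chomE. Qed.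

Fact ctens_comp V V' V'' W W' W'' (f : colorHom V V') (f' : colorHom V' V'')
    (g : colorHom W W') (g' : colorHom W' W'') :
  chom_tens (chom_comp f' f) (chom_comp g' g) =
  chom_comp (chom_tens f' g') (chom_tens f g).
Proof. by apply: chom_ext2 => a b v w _ _; rewrite !chomE. Qed.

Fact ctens_addl V V' W W' (f f' : colorHom V V') (g : colorHom W W') :
  chom_tens (f + f') g = chom_tens f g + chom_tens f' g.
Proof.
by apply: chom_ext2 => a b v w _ _; rewrite chom_addE !chomE chom_addE linearDl.
Qed.

Fact ctens_addr V V' W W' (f : colorHom V V') (g g' : colorHom W W') :
  chom_tens f (g + g') = chom_tens f g + chom_tens f g'.
Proof.
by apply: chom_ext2 => a b v w _ _; rewrite chom_addE !chomE chom_addE linearDr.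
Qed.

Fact cassl_nat X X' Y Y' Z Z' (f : colorHom X X') (g : colorHom Y Y')
    (h : colorHom Z Z') :
  chom_comp (chom_assl X' Y' Z') (chom_tens f (chom_tens g h)) =
  chom_comp (chom_tens (chom_tens f g) h) (chom_assl X Y Z).
Proof. by apply: chom_ext3r => a b c x y z _ _ _; rewrite !chomE. Qed.

Fact casslK X Y Z :
  chom_comp (chom_assr X Y Z) (chom_assl X Y Z) = chom_id _.
Proof. by apply: chom_ext3r => a b c x y z _ _ _; rewrite !chomE. Qed.

Fact cassrK X Y Z :
  chom_comp (chom_assl X Y Z) (chom_assr X Y Z) = chom_id _.
Proof. by apply: chom_ext3l => a b c x y z _ _ _; rewrite !chomE. Qed.

Fact clunit_nat X Y (f : colorHom X Y) :
  chom_comp (chom_lunit Y) (chom_tens (chom_id cunit) f) =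
  chom_comp f (chom_lunit X).
Proof. by apply: chom_ext2 => a b c v _ _; rewrite !chomE linearZ. Qed.

Fact clunitK X : chom_comp (chom_lunitV X) (chom_lunit X) = chom_id _.
Proof.
apply: chom_ext2 => a b c v _ _; rewrite !chomE -[LHS]/(pure (1 : cunit) (c *: v)) pureZr -pureZl.
by congr pure; rewrite [LHS]mulr1.
Qed.

Fact clunitVK X : chom_comp (chom_lunit X) (chom_lunitV X) = chom_id X.
Proof. by apply: chom_eqP => v; rewrite chom_compE chom_lunitE scale1r. Qed.

Fact crunit_nat X Y (f : colorHom X Y) :
  chom_comp (chom_runit Y) (chom_tens f (chom_id cunit)) =
  chom_comp f (chom_runit X).
Proof. by apply: chom_ext2 => a b v c _ _; rewrite !chomE linearZ. Qed.

Fact crunitK X : chom_comp (chom_runitV X) (chom_runit X) = chom_id _.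
Proof.
apply: chom_ext2 => a b v c _ _; rewrite !chomE -[LHS]/(pure ((c : k) *: v) (1 : cunit)) pureZl -pureZr.
by congr pure; rewrite [LHS]mulr1.
Qed.

Fact crunitVK X : chom_comp (chom_runit X) (chom_runitV X) = chom_id X.
Proof. by apply: chom_eqP => v; rewrite chom_compE chom_runitE scale1r. Qed.

Fact cpentagon X Y Z T :
  chom_comp (chom_assl (ctens X Y) Z T) (chom_assl X Y (ctens Z T)) =
  chom_comp (chom_tens (chom_assl X Y Z) (chom_id T))
    (chom_comp (chom_assl X (ctens Y Z) T)
      (chom_tens (chom_id X) (chom_assl Y Z T))).
Proof. by apply: chom_ext4r => x y z t; rewrite !chomE. Qed.

Fact ctriangle X Y :
  chom_comp (chom_tens (chom_runit X) (chom_id Y)) (chom_assl X cunit Y) =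
  chom_tens (chom_id X) (chom_lunit Y).
Proof.
by apply: chom_ext3r => a b c x u y _ _ _; rewrite !chomE pureZl pureZr.
Qed.

Section ColorSymmetry.
Variable chi : bicharacter G k.

Fact ctau_nat X X' Y Y' (f : colorHom X X') (g : colorHom Y Y') :
  chom_comp (chom_tau chi X' Y') (chom_tens f g) =
  chom_comp (chom_tens g f) (chom_tau chi X Y).
Proof.
apply: chom_ext2 => a b x y hx hy; rewrite !chomE (chom_tauE _ hx hy).
by rewrite (chom_tauE _ (chom_homog f hx) (chom_homog g hy)) chomZ chomE.
Qed.

Fact ctauK X Y : chom_comp (chom_tau chi Y X) (chom_tau chi X Y) = chom_id _.
Proof.
apply: chom_ext2 => a b x y hx hy; rewrite !chomE (chom_tauE _ hx hy).
by rewrite chomZ (chom_tauE _ hy hx) scalerA bichar_anti scale1r.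
Qed.

Fact chexagon X Y Z :
  chom_tau chi X (ctens Y Z) =
  chom_comp (chom_assl Y Z X)
    (chom_comp (chom_tens (chom_id Y) (chom_tau chi X Z))
      (chom_comp (chom_assr Y X Z)
        (chom_comp (chom_tens (chom_tau chi X Y) (chom_id Z))
          (chom_assl X Y Z)))).
Proof.
apply: chom_ext3r => a b c x y z hx hy hz; rewrite !chomE.
rewrite (chom_tauE _ hx hy) (chom_tauE _ hx (homog_pure hy hz)) pureZl.
rewrite !chomZ !chomE (chom_tauE _ hx hz) pureZr.
by rewrite chomZ chomE scalerA bichar_addr.
Qed.

Definition colorCat : symMonCat :=
  @SymMonCat (colorSpace k G) (@colorHom k G) chom_id chom_comp
    ctens chom_tens cunit chom_assl chom_assr chom_lunit chom_lunitV
    chom_runit chom_runitV (chom_tau chi)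
    (fun _ _ f => @chom_eqP k G _ _ (chom_comp (chom_id _) f) f (fun=> erefl))
    (fun _ _ f => @chom_eqP k G _ _ (chom_comp f (chom_id _)) f (fun=> erefl))
    (fun _ _ _ _ f g h => @chom_eqP k G _ _
      (chom_comp h (chom_comp g f)) (chom_comp (chom_comp h g) f) (fun=> erefl))
    (fun _ _ _ f g g' => @chom_eqP k G _ _
      (chom_comp (g + g') f) (chom_comp g f + chom_comp g' f) (fun=> erefl))
    (fun _ _ _ f f' g => @chom_eqP k G _ _
      (chom_comp g (f + f')) (chom_comp g f + chom_comp g f')
      (fun v => linearD g (f v) (f' v)))
    ctens_id ctens_comp ctens_addl ctens_addr cassl_nat casslK cassrK
    clunit_nat clunitK clunitVK crunit_nat crunitK crunitVK cpentagon ctriangle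
    ctau_nat ctauK chexagon.

End ColorSymmetry.

End ColorCat.

Definition is_basis (k : fieldType) (V : lmodType k) (I : finType)
    (b : I -> V) : Prop :=
  bijective (fun c : {ffun I -> k} => \sum_i c i *: b i).

(* Main.v *)
Require Import Defs.
From HB Require Import structures.
From mathcomp Require Import all_boot all_order all_algebra.

Set Implicit Arguments.
Unset Strict Implicit.
Unset Printing Implicit Defensive.

Import GRing.Theory.
Local Open Scope ring_scope.

(** The objects in sight have explicit finite bases, so morphisms are built by
prescribing values on basis vectors, and every identity between morphisms is
checked on pure tensors of basis vectors. What keeps this short is the shape
that the crossed modules over the line f = k s take: the coaction is diagonal
on weight vectors, lambda v = m (s (x) v), and for v, w of weights m, n

  eta_hat (v (x) w) = n (s.v) (x) w + m v (x) (s.w)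

([eta_hat_pure]): the sign that tau contributes to zeta is cancelled by the
second tau.

Write J = J1 + J2 for the splitting into degrees g and g^2; weights and degrees
agree. The bracket maps J1 (x) J1 to J2 and the cobracket maps J2 to J1 (x) J1;
both vanish otherwise. Hence any two successive brackets, or two successive
cobrackets, compose to zero, so that the Jacobi and co-Jacobi identities are
void and only (anti)symmetry is left. Both maps respect the weights because
2 = 1 + 1, and commute with the action, a shift of the second index, by
inspection.

In the compatibility condition put

  D = (beta (x) id) (id (x) tau) (delta (x) id),   A = id - tau.

The condition reads delta beta = A (D - D tau - eta_hat). It holds for a
different reason on each of the four summands Ji (x) Jj:
- on J1 (x) J1 both D terms vanish and delta beta = - A eta_hat
  ([delta_beta_x1]);
- on J2 (x) J1, D coincides with eta_hat ([D_x21]), D tau vanishes, and so does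
  delta beta;
- on J1 (x) J2, D tau = tau eta_hat by the previous case, as eta_hat commutes
  with tau, and A (tau + id) = 0;
- on J2 (x) J2 both D terms vanish and the image of eta_hat is symmetric
  ([eta_hat_x2]).

The infinitesimal braiding is nonzero because it sends x_11 (x) x_12 to
x_11 (x) x_11. *)

(** * Finite bases of graded spaces and of their tensor products *)

Section Bases.
Variable k : fieldType.

Lemma basis_dual (V : lmodType k) (I : finType) (b : I -> V) : is_basis b ->
  exists c : I -> {linear V -> k^o},
    (forall v, v = \sum_i (c i v : k) *: b i) /\
    (forall i j, c i (b j) = (i == j)%:R).
Proof.
case=> h hK Kh.
have h_lin i : linear ((fun v => h v i) : V -> k^o).
  move=> a u v.
  suff -> : h (a *: u + v) = [ffun i => a * h u i + h v i] by rewrite ffunE.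
  rewrite -[RHS]hK; congr (h _).
  rewrite -[in LHS](Kh u) -[in LHS](Kh v) scaler_sumr -big_split.
  by apply: eq_bigr => j _; rewrite ffunE scalerDl scalerA.
exists (fun i => mk_linear (h_lin i)); split=> [v|i j] /=; first by rewrite Kh.
have -> : b j = \sum_i [ffun i => (i == j)%:R] i *: b i.
  rewrite (bigD1 j) //= big1 ?addr0 => [|l /negPf ne].
    by rewrite ffunE eqxx scale1r.
  by rewrite ffunE ne scale0r.
by rewrite hK ffunE.
Qed.

Definition spans (V : lmodType k) (I : finType) (b : I -> V) : Prop :=
  forall v, exists c : I -> k, v = \sum_i c i *: b i.

Lemma basis_spans (V : lmodType k) (I : finType) (b : I -> V) :
  is_basis b -> spans b.
Proof.
by move=> /basis_dual[c [cE _]] v; exists (fun i => c i v); apply: cE.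
Qed.

Lemma pure_spans (V W : lmodType k) (I J : finType) (b : I -> V) (c : J -> W) :
  spans b -> spans c -> spans (fun p : I * J => pure (b p.1) (c p.2)).
Proof.
move=> bs cs; apply: tens_ind => [|_ _ [d ->] [e ->]|v w].
- by exists (fun=> 0); rewrite big1 // => p _; rewrite scale0r.
- exists (fun p => d p + e p); rewrite -big_split.
  by apply: eq_bigr => p _; rewrite scalerDl.
- have [d ->] := bs v; have [e ->] := cs w; exists (fun p => d p.1 * e p.2).
  rewrite linear_sumlz.
  rewrite -(pair_bigA _ (fun i j => (d i * e j) *: pure (b i) (c j))) /=.
  apply: eq_bigr => i _; rewrite linear_sumr; apply: eq_bigr => j _.
  by rewrite linearZl_LR linearZr_LR /= scalerA.
Qed.

End Bases.

Section ColorBases.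
Variables (k : fieldType) (G : zmodType).
Implicit Types V W X : colorSpace k G.

Lemma chom_spans_ext V W (I : finType) (b : I -> V) (h h' : colorHom V W) :
  spans b -> (forall i, h (b i) = h' (b i)) -> h = h'.
Proof.
move=> bs H; apply: chom_eqP => v; have [c ->] := bs v.
by rewrite !linear_sum; apply: eq_bigr => i _; rewrite !linearZ /= H.
Qed.

Lemma dual_homog V (I : finType) (b : I -> V) (d : I -> G)
    (c : I -> {linear V -> k^o}) :
  (forall v, v = \sum_i (c i v : k) *: b i) ->
  (forall i j, c i (b j) = (i == j)%:R) ->
  (forall i, homog (d i) (b i)) ->
  forall a v i, homog a v -> a != d i -> c i v = 0.
Proof.
move=> cE cb hb a v i hv ne; rewrite -hv [v]cE !linear_sum big1 // => j _.
rewrite !linearZ /= (homog_prE _ (hb j)); case: eqP => [ad|_].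
  rewrite cb; case: eqP => [ij|_]; last exact: scaler0.
  by rewrite ad ij eqxx in ne.
by rewrite linear0 scaler0.
Qed.

(** A linear map that sends a homogeneous basis to vectors of the same degrees
preserves degrees, since the coordinates of a homogeneous vector are supported
on the basis vectors of its own degree. *)
Lemma exists_chom V W (I : finType) (b : I -> V) (d : I -> G) (F : I -> W) :
  is_basis b -> (forall i, homog (d i) (b i)) ->
  (forall i, homog (d i) (F i)) ->
  exists h : colorHom V W, forall i, h (b i) = F i.
Proof.
move=> /basis_dual[c [cE cb]] hb hF.
pose h v := \sum_i (c i v : k) *: F i.
have h_lin : linear h.
  move=> a u v; rewrite /h scaler_sumr -big_split; apply: eq_bigr => i _ /=.
  by rewrite linearP scalerDl -scalerA.
have h_hom a v : homog a v -> homog a (h v).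
  move=> hv; apply: homog_sum => i.
  have [->|ne] := eqVneq a (d i); first exact/homogZ/hF.
  by rewrite (dual_homog cE cb hb hv ne) scale0r; apply: homog0.
exists (ColorHom h_lin h_hom) => i /=; rewrite /h (bigD1 i) //= cb eqxx scale1r.
by rewrite big1 ?addr0 // => j /negPf ne; rewrite cb ne scale0r.
Qed.

Lemma exists_chom2 V W X (I J : finType) (b : I -> V) (c : J -> W)
    (d : I -> G) (e : J -> G) (F : I -> J -> X) :
  is_basis b -> is_basis c ->
  (forall i, homog (d i) (b i)) -> (forall j, homog (e j) (c j)) ->
  (forall i j, homog (d i + e j) (F i j)) ->
  exists h : colorHom (ctens V W) X,
    forall i j, h (pure (b i) (c j)) = F i j.
Proof.
move=> b_basis c_basis hb hc hF.
have [p [pE pb]] := basis_dual b_basis.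
have [q [qE qc]] := basis_dual c_basis.
pose h v w := \sum_i \sum_j ((p i v : k) * (q j w : k)) *: F i j.
have h_bil : is_bilinear h.
  split=> [w|v] a u u'; rewrite /h scaler_sumr -big_split;
    apply: eq_bigr => i _ /=;
    rewrite scaler_sumr -big_split; apply: eq_bigr => j _ /=;
    rewrite linearP /= scalerA -scalerDl; congr (_ *: _).
    by rewrite mulrDl -mulrA.
  by rewrite mulrDr mulrCA.
have h_hom a a' v w : homog a v -> homog a' w -> homog (a + a') (h v w).
  move=> hv hw; apply: homog_sum => i; apply: homog_sum => j.
  have [->|ne] := eqVneq a (d i).
    have [->|ne'] := eqVneq a' (e j); first exact/homogZ/hF.
    by rewrite (dual_homog qE qc hc hw ne') mulr0 scale0r; apply: homog0.
  by rewrite (dual_homog pE pb hb hv ne) mul0r scale0r; apply: homog0.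
exists (chom_lift h_bil h_hom) => i j.
rewrite chom_liftE /h (bigD1 i) //= (bigD1 j) //=.
rewrite pb qc !eqxx mulr1 scale1r !big1 ?addr0 // => l /negPf ne.
  by rewrite big1 // => m _; rewrite pb ne mul0r scale0r.
by rewrite qc ne mulr0 scale0r.
Qed.

(** The product of the two functionals is a bilinear form, hence a linear
functional on the tensor product, and it takes the value 1 on the pure tensor. *)
Lemma pure_neq0 V W (v : V) (w : W)
    (p : {linear V -> k^o}) (q : {linear W -> k^o}) :
  p v = 1 -> q w = 1 -> pure v w <> 0.
Proof.
move=> pv qw pvw0.
have pq_bil : is_bilinear (fun v w => (p v : k) * q w : k^o).
  split=> [u|u] a y z; rewrite linearP /=.
    by rewrite mulrDl -mulrA.
  by rewrite mulrDr mulrCA.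
have := liftE (mk_bilinear pq_bil) v w.
rewrite pvw0 linear0 /= pv qw mulr1 => /eqP.
by rewrite eq_sym oner_eq0.
Qed.

End ColorBases.

(** * Morphisms of color vector spaces acting on pure tensors *)

Section Eval.
Local Open Scope moncat_scope.
Local Notation Hom := Defs.Hom.
Variables (k : fieldType) (G : zmodType) (chi : bicharacter G k).
Local Notation C := (zeroCartier (colorCat chi)).

(** With names for underlying spaces, for the action of morphisms on vectors
([app]) and for pure tensors ([tpure]), objects keep their categorical form, so
that the laws of the category and the evaluation rules rewrite the same terms. *)
Definition vec (X : C) : colorSpace k G := X.

Implicit Types X Y Z : C.

Definition app X Y (h : Hom X Y) : vec X -> vec Y :=
  chom_fun (h : colorHom X Y).

Fact app_linear X Y (h : Hom X Y) : linear (app h).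
Proof. exact: chom_linear. Qed.

HB.instance Definition _ X Y (h : Hom X Y) :=
  GRing.isLinear.Build k (vec X) (vec Y) *:%R (app h) (app_linear h).

Definition tpure X Y (v : vec X) (w : vec Y) : vec (X ⊠ Y) := pure v w.

Fact tpure_bilinear X Y : is_bilinear (@tpure X Y).
Proof. exact: pure_bilinear. Qed.

HB.instance Definition _ X Y :=
  bilinear_isBilinear.Build k (vec X) (vec Y) (vec (X ⊠ Y)) *:%R *:%R
    (@tpure X Y)
    ((tpure_bilinear X Y).1, (tpure_bilinear X Y).2).

Lemma app_ext X Y (h h' : Hom X Y) (I : finType) (b : I -> vec X) :
  spans b -> (forall i, app h (b i) = app h' (b i)) -> h = h'.
Proof. exact: chom_spans_ext. Qed.

Lemma tpure_spans X Y (I J : finType) (b : I -> vec X) (c : J -> vec Y) :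
  spans b -> spans c -> spans (fun p : I * J => tpure (b p.1) (c p.2)).
Proof. exact: pure_spans. Qed.

Lemma app_comp X Y Z (g : Hom Y Z) (h : Hom X Y) v :
  app (g ∘ h) v = app g (app h v).
Proof. by []. Qed.

Lemma app_id X v : app (idm X) v = v.
Proof. by []. Qed.

Lemma app_add X Y (g h : Hom X Y) v : app (g + h) v = app g v + app h v.
Proof. by []. Qed.

Lemma app_opp X Y (h : Hom X Y) v : app (- h) v = - app h v.
Proof. by []. Qed.

Lemma app_zero X Y v : app (0 : Hom X Y) v = 0.
Proof. by []. Qed.

Lemma app_tmor X Y X' Y' (g : Hom X X') (h : Hom Y Y') v w :
  app (g ⊗ h) (tpure v w) = tpure (app g v) (app h w).
Proof. exact: chom_tensE. Qed.

Lemma app_assl X Y Z v w u :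
  app (assl X Y Z) (tpure v (tpure w u)) = tpure (tpure v w) u.
Proof. exact: chom_asslE. Qed.

Lemma app_assr X Y Z v w u :
  app (assr X Y Z) (tpure (tpure v w) u) = tpure v (tpure w u).
Proof. exact: chom_assrE. Qed.

Lemma app_tau X Y a b (v : vec X) (w : vec Y) : homog a v -> homog b w ->
  app (tau X Y) (tpure v w) = chi a b *: tpure w v.
Proof. exact: chom_tauE. Qed.

Definition appE := (app_add, app_opp, app_zero, app_comp, app_id, app_tmor,
  app_assl, app_assr).

Lemma app0 X Y (h : Hom X Y) : app h 0 = 0.
Proof. exact: linear0. Qed.
Lemma appD X Y (h : Hom X Y) v w : app h (v + w) = app h v + app h w.
Proof. exact: linearD. Qed.
Lemma appN X Y (h : Hom X Y) v : app h (- v) = - app h v.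
Proof. exact: linearN. Qed.
Lemma appZ X Y (h : Hom X Y) c v : app h (c *: v) = c *: app h v.
Proof. exact: linearZ. Qed.

Lemma tpure0l X Y (w : vec Y) : tpure (0 : vec X) w = 0.
Proof. exact: linear0l. Qed.
Lemma tpure0r X Y (v : vec X) : tpure v (0 : vec Y) = 0.
Proof. exact: linear0r. Qed.
Lemma tpureDl X Y (v v' : vec X) (w : vec Y) :
  tpure (v + v') w = tpure v w + tpure v' w.
Proof. exact: linearDl. Qed.
Lemma tpureDr X Y (v : vec X) (w w' : vec Y) :
  tpure v (w + w') = tpure v w + tpure v w'.
Proof. exact: linearDr. Qed.
Lemma tpureNl X Y (v : vec X) (w : vec Y) : tpure (- v) w = - tpure v w.
Proof. exact: linearNl. Qed.
Lemma tpureNr X Y (v : vec X) (w : vec Y) : tpure v (- w) = - tpure v w.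
Proof. exact: linearNr. Qed.
Lemma tpureZl X Y c (v : vec X) (w : vec Y) : tpure (c *: v) w = c *: tpure v w.
Proof. exact: linearZl_LR. Qed.
Lemma tpureZr X Y c (v : vec X) (w : vec Y) : tpure v (c *: w) = c *: tpure v w.
Proof. exact: linearZr_LR. Qed.

Definition linE := (app0, appD, appN, appZ, tpure0l, tpure0r, tpureDl, tpureDr,
  tpureNl, tpureNr, tpureZl, tpureZr).

Lemma app_homog X Y (h : Hom X Y) a (v : vec X) :
  homog a v -> homog a (app h v).
Proof. exact: chom_homog. Qed.

Lemma bichar0l a : chi 0 a = 1.
Proof.
have := bichar_addl chi 0 0 a; rewrite addr0 => /eqP.
have nz : chi 0 a != 0.
  apply/eqP => E; have /eqP := bichar_anti chi 0 a.
  by rewrite E mul0r eq_sym oner_eq0.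
by rewrite -{1}[chi 0 a]mulr1 (inj_eq (mulfI nz)) eq_sym => /eqP.
Qed.

Lemma bichar0r a : chi a 0 = 1.
Proof. by have := bichar_anti chi a 0; rewrite bichar0l mulr1. Qed.

Lemma bichar_pow g i j : chi (g *+ i) (g *+ j) = chi g g ^+ (i * j).
Proof.
have powl h n : chi (h *+ n) g = chi h g ^+ n.
  elim: n => [|n IH]; first by rewrite mulr0n bichar0l expr0.
  by rewrite mulrS bichar_addl IH exprS.
elim: j => [|j IH]; first by rewrite mulr0n bichar0r muln0 expr0.
by rewrite mulrS bichar_addr IH powl mulnS exprD.
Qed.

End Eval.

Arguments app : simpl never.
Arguments tpure : simpl never.

(** * Crossed modules over an abelian line of degree zero *)

Section Line.
Local Open Scope moncat_scope.
Local Notation Hom := Defs.Hom.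
Variables (k : fieldType) (G : zmodType) (chi : bicharacter G k).
Variables (f : colorSpace k G).
Local Notation C := (zeroCartier (colorCat chi)).
Local Notation ff := (@zeroLieBialgebra (colorCat chi) f).
Variable s : vec (ff : C).
Hypotheses (s_deg : homog 0 s) (s_spans : spans (fun _ : 'I_1 => s)).

(** On a line the coaction is s tensored with an endomorphism, and a vector of
weight m is an eigenvector of this endomorphism. *)
Definition weight (V : C) (lambda : Hom V (ff ⊠ V)) (m : k) (v : vec V) : Prop :=
  app lambda v = m *: tpure s v.

(** The degree of s is neutral and the bicharacter is trivial there, so tau moves
s past any vector without a sign. *)
Lemma tau_line (V : C) (v : vec V) :
  app (tau ff V) (tpure s v) = tpure v s.
Proof.
elim/homog_ind: v => [|v w Hv Hw|a v hv].
- by rewrite !linE.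
- by rewrite !linE Hv Hw.
- by rewrite (app_tau s_deg hv) bichar0l scale1r.
Qed.

Lemma tau_line_r (V : C) (v : vec V) :
  app (tau V ff) (tpure v s) = tpure s v.
Proof. by rewrite -tau_line -app_comp tauK. Qed.

(** Bracket and cobracket of the line are zero and tau is the identity on its
square, so both sides of the first two axioms vanish; the third one says that
the action preserves weights. *)
Lemma is_crossed_module_line (V : C) (I : finType) (e : I -> vec V)
    (alpha : Hom (ff ⊠ V) V) (lambda : Hom V (ff ⊠ V)) (m : I -> k) :
  spans e -> (forall i, weight lambda (m i) (e i)) ->
  (forall i, weight lambda (m i) (app alpha (tpure s (e i)))) ->
  @is_crossed_module C ff V alpha lambda.
Proof.
move=> e_spans we wae; split.
- apply: (app_ext (tpure_spans (tpure_spans s_spans s_spans) e_spans)) => i.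
  by rewrite !appE tau_line subrr !linE.
- apply: (app_ext e_spans) => i.
  by rewrite !appE we !linE !appE we !linE !appE tau_line subrr scaler0.
- apply: (app_ext (tpure_spans s_spans e_spans)) => -[i j].
  rewrite !appE wae we !linE !appE tau_line !appE.
  by rewrite !linE scaler0 add0r addr0 subr0.
Qed.

Section Products.
Variables V W : crossedModule ff.
Local Notation act V v := (app (cm_act V) (tpure s v)).

Lemma tens_act_pure (v : vec V) (w : vec W) :
  app (tens_act V W) (tpure s (tpure v w)) =
   tpure (act V v) w + tpure v (act W w).
Proof. by rewrite !appE tau_line !appE. Qed.

Lemma tens_coact_pure m n (v : vec V) (w : vec W) :
  weight (cm_coact V) m v -> weight (cm_coact W) n w ->
  weight (tens_coact V W) (m + n) (tpure v w).
Proof.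
move=> hv hw; rewrite /weight !appE hv hw !linE !appE tau_line_r !appE.
by rewrite scalerDl.
Qed.

End Products.

Lemma zeta_pure (V W : crossedModule ff) m (v : vec V) (w : vec W) a b :
  homog a v -> homog b w -> weight (cm_coact V) m v ->
  app (zeta V W) (tpure v w) =
  (m * chi a b) *: tpure (app (cm_act W) (tpure s w)) v.
Proof.
move=> hv hw mv; rewrite !appE mv !linE !appE (app_tau hv hw).
by rewrite !linE !appE scalerA.
Qed.

(** Each half of eta_hat contains tau once inside zeta and once outside, in
opposite directions; as the bicharacter is antisymmetric, the signs cancel. *)
Lemma eta_hat_pure (V W : crossedModule ff) m n (v : vec V) (w : vec W) a b :
  homog a v -> homog b w ->
  weight (cm_coact V) m v -> weight (cm_coact W) n w ->
  app (eta_hat V W) (tpure v w) =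
  n *: tpure (app (cm_act V) (tpure s v)) w +
  m *: tpure v (app (cm_act W) (tpure s w)).
Proof.
move=> hv hw mv nw.
rewrite 2!app_add app_zero addr0 app_comp [X in _ + X]app_comp.
rewrite (app_tau hv hw) linE (zeta_pure hw hv nw) (zeta_pure hv hw mv).
have hsw : homog b (app (cm_act W) (tpure s w)).
  by apply: app_homog; rewrite -[b]add0r; apply: homog_pure.
rewrite !linE (app_tau hsw hv) !scalerA.
by rewrite mulrCA bichar_anti -mulrA bichar_anti !mulr1.
Qed.

End Line.

(** * Symmetry of the infinitesimal braiding *)

Section Symmetry.
Local Open Scope moncat_scope.
Variables (C : cartierCat) (h : lieBialgebra C).

(** Precomposing with tau exchanges the two terms of eta_hat that contain zeta. *)
Lemma eta_hat_tau (U W : crossedModule h) :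
  eta_hat W U ∘ tau U W = tau U W ∘ eta_hat U W.
Proof.
rewrite /eta_hat !comp_addl !comp_addr eta_tau.
rewrite -[in LHS]comp_assoc tauK comp_idr [in RHS]comp_assoc [in RHS]comp_assoc.
by rewrite tauK comp_idl -comp_assoc [X in X + _ = _]addrC.
Qed.

End Symmetry.

(** * The four-dimensional Lie bialgebra *)

Lemma in12_ind (P : nat -> Prop) :
  P 1%N -> P 2%N -> forall i, (1 <= i <= 2)%N -> P i.
Proof. by move=> P1 P2 [|[|[|//]]]. Qed.

Lemma in12_ord (P : nat -> nat -> Prop) :
  (forall p : 'I_2 * 'I_2, P p.1.+1 p.2.+1) ->
  forall i j, (1 <= i <= 2)%N -> (1 <= j <= 2)%N -> P i j.
Proof.
by move=> H [|i] [|j] //= hi hj; apply: (H (Ordinal hi, Ordinal hj)).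
Qed.

Section JMinus.
Local Open Scope moncat_scope.
Local Notation Hom := Defs.Hom.
Variables (k : fieldType) (G : zmodType) (chi : bicharacter G k) (g : G).
Variables (f : colorSpace k G).
Local Notation C := (zeroCartier (colorCat chi)).
Local Notation ff := (@zeroLieBialgebra (colorCat chi) f).
Variable s : vec (ff : C).
Hypotheses (s_deg : homog 0 s) (s_spans : spans (fun _ : 'I_1 => s)).
Hypothesis chi_gg : chi g g = -1.
Variables (V : crossedModule ff) (x : nat -> nat -> vec V).
Hypothesis x_spans : spans (fun p : 'I_2 * 'I_2 => x p.1.+1 p.2.+1).
Hypothesis x_deg : forall i j : nat, (1 <= i <= 2)%N -> (1 <= j <= 2)%N ->
     homog (g *+ i) (x i j).
Hypothesis x_act : forall i j : nat, (1 <= i <= 2)%N -> (1 <= j <= 2)%N ->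
  app (cm_act V) (tpure s (x i j)) = x i (j - 1)%N.
Hypothesis x_weight : forall i j : nat, (1 <= i <= 2)%N -> (1 <= j <= 2)%N ->
  weight s (cm_coact V) i%:R (x i j).
Hypothesis x_0 : forall i : nat, (1 <= i <= 2)%N -> x i 0%N = 0.

Variables (beta : Hom (V ⊠ V) V) (delta : Hom V (V ⊠ V)).
Hypothesis beta_x1 : forall i j, (1 <= i <= 2)%N -> (1 <= j <= 2)%N ->
  app beta (tpure (x 1 i) (x 1 j)) = (i + j - 2)%:R *: x 2 (i + j - 2).
Hypothesis beta_x2 : forall i v, (1 <= i <= 2)%N ->
  app beta (tpure (x 2 i) v) = 0 /\ app beta (tpure v (x 2 i)) = 0.
Hypothesis delta_x1 : forall i, (1 <= i <= 2)%N -> app delta (x 1 i) = 0.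
Hypothesis delta_x2 : forall i, (1 <= i <= 2)%N ->
  app delta (x 2 i) = - tpure (x 1 1) (x 1 i) - tpure (x 1 i) (x 1 1).

Lemma x_ext (W : C) (h h' : Hom V W) :
  (forall i, (1 <= i <= 2)%N -> forall a, (1 <= a <= 2)%N ->
    app h (x i a) = app h' (x i a)) -> h = h'.
Proof.
move=> H; apply: (app_ext x_spans) => p.
by apply: H; rewrite ltnS /= ltn_ord.
Qed.

Lemma x_ext2 (W : C) (h h' : Hom (V ⊠ V) W) :
  (forall i, (1 <= i <= 2)%N -> forall j, (1 <= j <= 2)%N ->
   forall a, (1 <= a <= 2)%N -> forall b, (1 <= b <= 2)%N ->
    app h (tpure (x i a) (x j b)) = app h' (tpure (x i a) (x j b))) -> h = h'.
Proof.
move=> H; apply: (app_ext (tpure_spans x_spans x_spans)) => p.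
by apply: H; rewrite ltnS /= ltn_ord.
Qed.

Fact act11 : app (cm_act V) (tpure s (x 1 1)) = 0.
Proof. by rewrite x_act // x_0. Qed.
Fact act12 : app (cm_act V) (tpure s (x 1 2)) = x 1 1.
Proof. by rewrite x_act. Qed.
Fact act21 : app (cm_act V) (tpure s (x 2 1)) = 0.
Proof. by rewrite x_act // x_0. Qed.
Fact act22 : app (cm_act V) (tpure s (x 2 2)) = x 2 1.
Proof. by rewrite x_act. Qed.
Definition actE := (act11, act12, act21, act22).

Fact beta11 : app beta (tpure (x 1 1) (x 1 1)) = 0.
Proof. by rewrite beta_x1 // x_0 // scaler0. Qed.
Fact beta12 : app beta (tpure (x 1 1) (x 1 2)) = x 2 1.
Proof. by rewrite beta_x1 // scale1r. Qed.
Fact beta21 : app beta (tpure (x 1 2) (x 1 1)) = x 2 1.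
Proof. by rewrite beta_x1 // scale1r. Qed.
Fact beta22 : app beta (tpure (x 1 2) (x 1 2)) = x 2 2 + x 2 2.
Proof. by rewrite beta_x1 // scaler_nat. Qed.
Fact beta_x2l i v : (1 <= i <= 2)%N -> app beta (tpure (x 2 i) v) = 0.
Proof. by move=> /(beta_x2 v)[]. Qed.
Fact beta_x2r i v : (1 <= i <= 2)%N -> app beta (tpure v (x 2 i)) = 0.
Proof. by move=> /(beta_x2 v)[]. Qed.
Definition betaE := (beta11, beta12, beta21, beta22,
  @beta_x2l 1 ^~ isT, @beta_x2r 1 ^~ isT,
  @beta_x2l 2 ^~ isT, @beta_x2r 2 ^~ isT).

Fact delta11 : app delta (x 1 1) = 0.
Proof. exact: delta_x1. Qed.
Fact delta12 : app delta (x 1 2) = 0.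
Proof. exact: delta_x1. Qed.
Fact delta21 :
  app delta (x 2 1) = - tpure (x 1 1) (x 1 1) - tpure (x 1 1) (x 1 1).
Proof. exact: delta_x2. Qed.
Fact delta22 :
  app delta (x 2 2) = - tpure (x 1 1) (x 1 2) - tpure (x 1 2) (x 1 1).
Proof. exact: delta_x2. Qed.
Definition deltaE := (delta11, delta12, delta21, delta22).

Lemma tau_x i j a b : (1 <= i <= 2)%N -> (1 <= j <= 2)%N ->
  (1 <= a <= 2)%N -> (1 <= b <= 2)%N ->
  app (tau V V) (tpure (x i a) (x j b)) =
  if odd (i * j) then - tpure (x j b) (x i a) else tpure (x j b) (x i a).
Proof.
move=> hi hj ha hb; rewrite (app_tau (x_deg hi ha) (x_deg hj hb)).
by rewrite bichar_pow chi_gg -signr_odd; case: odd; rewrite ?scaleN1r ?scale1r.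
Qed.

Lemma eta_hat_x i j a b : (1 <= i <= 2)%N -> (1 <= j <= 2)%N ->
  (1 <= a <= 2)%N -> (1 <= b <= 2)%N ->
  app (eta_hat V V) (tpure (x i a) (x j b)) =
  tpure (x i a.-1) (x j b) *+ j + tpure (x i a) (x j b.-1) *+ i.
Proof.
move=> hi hj ha hb.
rewrite (eta_hat_pure s_deg (x_deg hi ha) (x_deg hj hb)
  (x_weight hi ha) (x_weight hj hb)).
by rewrite !x_act // !scaler_nat !subn1.
Qed.

(** The bracket takes its values in the span of the x_2i, on which it vanishes,
so the Jacobi identity reads 0 = 0. *)
Lemma lie_algebra_x : is_lie_algebra beta.
Proof.
have bb_l : beta ∘ (beta ⊗ idm V) = 0.
  apply: (app_ext (tpure_spans (tpure_spans x_spans x_spans) x_spans)).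
  move=> [[p q] r] /=.
  rewrite !appE; move: (x r.1.+1 r.2.+1) => u.
  by case: p q => [[[|[|//]] ?] [[|[|//]] ?]] [[[|[|//]] ?] [[|[|//]] ?]] /=;
    rewrite !(betaE, linE) ?addr0.
have bb_r : beta ∘ (idm V ⊗ beta) = 0.
  apply: (app_ext (tpure_spans x_spans (tpure_spans x_spans x_spans))).
  move=> [r [p q]] /=.
  rewrite !appE; move: (x r.1.+1 r.2.+1) => u.
  by case: p q => [[[|[|//]] ?] [[|[|//]] ?]] [[[|[|//]] ?] [[|[|//]] ?]] /=;
    rewrite !(betaE, linE) ?addr0.
split; last by rewrite bb_l !comp_assoc bb_r !comp0m.
apply: x_ext2; do 4 apply: in12_ind.
all: by rewrite !appE tau_x //= !linE !betaE ?subrr ?addr0.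
Qed.

(** Each leg of the cobracket lies in the span of the x_1i, on which the
cobracket vanishes, so both sides of the co-Jacobi identity are zero. *)
Lemma lie_coalgebra_x : is_lie_coalgebra delta.
Proof.
have dd_l : (delta ⊗ idm V) ∘ delta = 0.
  by apply: x_ext; do 2 apply: in12_ind;
    rewrite !appE ?(deltaE, linE, appE) ?oppr0 ?addr0.
have dd_r : (idm V ⊗ delta) ∘ delta = 0.
  by apply: x_ext; do 2 apply: in12_ind;
    rewrite !appE ?(deltaE, linE, appE) ?oppr0 ?addr0.
split; last by rewrite dd_l dd_r !compm0.
apply: x_ext; do 2 apply: in12_ind.
all: rewrite !appE ?(deltaE, linE) ?addr0 // !tau_x //= !opprK.
- by rewrite addrACA !addNr addr0.
- by rewrite [X in _ + X]addrC addrACA !addNr addr0.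
Qed.

(** Up to id - tau on both sides, D is the bracket-cobracket part of the
compatibility condition. *)
Let D : Hom (V ⊠ V) (V ⊠ V) :=
  (beta ⊗ idm V) ∘ assl V V V ∘ (idm V ⊗ tau V V) ∘ assr V V V
    ∘ (delta ⊗ idm V).

Lemma D_x1 a w : (1 <= a <= 2)%N -> app D (tpure (x 1 a) w) = 0.
Proof. by move=> ha; rewrite !appE delta_x1 // !linE. Qed.

Lemma D_x22 a b : (1 <= a <= 2)%N -> (1 <= b <= 2)%N ->
  app D (tpure (x 2 a) (x 2 b)) = 0.
Proof.
move=> ha hb; rewrite !appE delta_x2 // !(linE, appE) !tau_x // !(linE, appE).
by rewrite !beta_x2r // !linE oppr0 addr0.
Qed.

(** Here delta (x_2a) = - x_11 (x) x_1a - x_1a (x) x_11, the minus sign cancels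
against tau on odd vectors, and bracketing with x_1b gives multiples of
x_(2,b-1) (x) x_1a and x_(2,a+b-2) (x) x_11. For each of the four pairs (a, b)
the sum is the value of eta_hat, although the coefficients there are the weights
1 and 2 instead of b - 1 and a + b - 2. *)
Lemma D_x21 a b : (1 <= a <= 2)%N -> (1 <= b <= 2)%N ->
  app D (tpure (x 2 a) (x 1 b)) = app (eta_hat V V) (tpure (x 2 a) (x 1 b)).
Proof.
move=> ha hb; rewrite eta_hat_x // !appE delta_x2 // !(linE, appE) !tau_x //=.
rewrite !(linE, appE) !opprK mulr1n; move: a ha b hb; do 2 apply: in12_ind.
all: by rewrite /= ?x_0 // !(betaE, linE) // ?mul0rn ?addr0 ?add0r // addrC.
Qed.

Local Notation A := (idm (V ⊠ V) - tau V V).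

(** As vectors of degree g are odd, - A symmetrizes: it sends v (x) w to
- v (x) w - w (x) v, which is the shape of the cobracket. *)
Lemma delta_beta_x1 a b : (1 <= a <= 2)%N -> (1 <= b <= 2)%N ->
  app delta (app beta (tpure (x 1 a) (x 1 b))) =
  - app A (app (eta_hat V V) (tpure (x 1 a) (x 1 b))).
Proof.
move=> ha hb; rewrite -app_opp opprB eta_hat_x // !mulr1n.
move: a ha b hb; do 2 apply: in12_ind.
all: rewrite !appE /= ?x_0 // !(betaE, linE) ?deltaE ?tau_x //=.
- by rewrite addr0 subr0.
- by rewrite !add0r.
- by rewrite !addr0.
- by congr (_ + _); rewrite ?opprD // addrC.
Qed.

(** For indices a = b the two terms of eta_hat are exchanged by tau, and
otherwise only 2 x_21 (x) x_21 survives. *)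
Lemma eta_hat_x2 a b : (1 <= a <= 2)%N -> (1 <= b <= 2)%N ->
  app A (app (eta_hat V V) (tpure (x 2 a) (x 2 b))) = 0.
Proof.
move=> ha hb; rewrite eta_hat_x // !mulr2n !appE.
move: a ha b hb; do 2 apply: in12_ind.
all: rewrite [_.-1]/= ?[_.-1]/= ?x_0 // !linE ?tau_x // ?addr0 ?subrr //.
by rewrite [X in _ - X]addrC subrr.
Qed.

Lemma compatibility_x :
  delta ∘ beta = A ∘ D ∘ A + (tau V V - idm (V ⊠ V)) ∘ eta_hat V V.
Proof.
have E u : app (A ∘ D ∘ A + (tau V V - idm (V ⊠ V)) ∘ eta_hat V V) u =
    app A (app D u - app D (app (tau V V) u) - app (eta_hat V V) u).
  rewrite app_add appD appN -[tau V V - _]opprB; congr (_ + _).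
  by rewrite appD appN -!appN -!appD appN.
apply: x_ext2; apply: in12_ind; apply: in12_ind => a ha b hb;
  rewrite E app_comp.
- rewrite tau_x // [app D (- _)]appN !D_x1 // oppr0 subr0 add0r appN.
  exact: delta_beta_x1.
(* The two arguments are swapped by tau so that D = eta_hat applies; what is
   left is A (- tau z - z) = 0. *)
- have -> : app (tau V V) (tpure (x 1 a) (x 2 b)) = tpure (x 2 b) (x 1 a).
    by rewrite tau_x.
  have -> : app (eta_hat V V) (tpure (x 1 a) (x 2 b)) =
      app (tau V V) (app (eta_hat V V) (tpure (x 2 b) (x 1 a))).
    by rewrite -app_comp -eta_hat_tau app_comp tau_x.
  rewrite beta_x2r // D_x1 // D_x21 //; move: (app (eta_hat V V) _) => z.
  by rewrite sub0r !linE !appE -(app_comp (tau V V)) tauK app_id opprB addrN.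
- by rewrite beta_x2l // D_x21 // tau_x // D_x1 // subr0 subrr !linE.
- rewrite beta_x2l // tau_x // !D_x22 // subrr sub0r app0 appN.
  by rewrite eta_hat_x2 // oppr0.
Qed.

Lemma beta_act : beta ∘ tens_act V V = cm_act V ∘ (idm ff ⊗ beta).
Proof.
apply: (app_ext (tpure_spans s_spans (tpure_spans x_spans x_spans))).
move=> [o [p q]] /=.
rewrite !app_comp (tens_act_pure s_deg) app_tmor app_id appD.
by case: p q => [[[|[|//]] ?] [[|[|//]] ?]] [[[|[|//]] ?] [[|[|//]] ?]] /=;
  rewrite !actE !(linE, betaE) ?actE ?linE ?addr0 ?add0r.
Qed.

Lemma delta_act : delta ∘ cm_act V = tens_act V V ∘ (idm ff ⊗ delta).
Proof.
apply: (app_ext (tpure_spans s_spans x_spans)) => -[o p] /=.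
rewrite !app_comp app_tmor app_id.
by case: p => [[[|[|//]] ?] [[|[|//]] ?]] /=;
  rewrite !actE !(linE, deltaE) // !(tens_act_pure s_deg) !actE !linE
    ?addr0 ?add0r ?oppr0 ?addr0.
Qed.

Lemma beta_coact : (idm ff ⊗ beta) ∘ tens_coact V V = cm_coact V ∘ beta.
Proof.
apply: x_ext2 => i hi j hj a ha b hb.
rewrite app_comp (tens_coact_pure s_deg (x_weight hi ha) (x_weight hj hb)).
rewrite linE app_tmor app_id app_comp -natrD.
move: i hi j hj a ha b hb; do 4 apply: in12_ind.
all: rewrite !betaE ?(linE, scaler0) // ?x_weight //.
by rewrite scalerDr.
Qed.

Lemma delta_coact : (idm ff ⊗ delta) ∘ cm_coact V = tens_coact V V ∘ delta.
Proof.
have w a b : (1 <= a <= 2)%N -> (1 <= b <= 2)%N ->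
    weight s (tens_coact V V) 2%:R (tpure (x 1 a) (x 1 b)).
  move=> ha hb.
  exact: (tens_coact_pure s_deg (@x_weight 1 a isT ha) (@x_weight 1 b isT hb)).
apply: x_ext => i hi a ha; rewrite !app_comp x_weight // linE app_tmor app_id.
move: i hi a ha; do 2 apply: in12_ind.
all: rewrite !deltaE ?(linE, scaler0) // !w //.
all: by rewrite scalerDr !scalerN.
Qed.

Lemma crossed_lie_bialgebra_x : is_crossed_lie_bialgebra beta delta.
Proof.
split; [exact: beta_act | exact: beta_coact | exact: delta_act
  | exact: delta_coact |].
split; [exact: lie_algebra_x | exact: lie_coalgebra_x |].
by rewrite compatibility_x /D !comp_assoc.
Qed.

End JMinus.

Theorem proposition7p3
  (k : fieldType)
  (G : zmodType) (g : G) (g_gen : bijective (fun n : int => g *~ n))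
  (chi : bicharacter G k) (chi_gg : chi g g = -1)
  (f : colorSpace k G) (s : f)
  (s_basis : is_basis (fun _ : 'I_1 => s)) (s_deg : homog 0 s)
  (J : colorSpace k G) (x : nat -> nat -> J)
  (x_basis : is_basis (fun p : 'I_2 * 'I_2 => x p.1.+1 p.2.+1))
  (x_deg : forall i j : nat, (1 <= i <= 2)%N -> (1 <= j <= 2)%N ->
     homog (g *~ i) (x i j))
  (x_0 : forall i : nat, (1 <= i <= 2)%N -> x i 0%N = 0) :
  let C : cartierCat := zeroCartier (colorCat chi) in
  let ff : lieBialgebra C := @zeroLieBialgebra (colorCat chi) f in
  exists (alpha : colorHom (ctens f J) J) (lambda : colorHom J (ctens f J))
         (J_crossed : @is_crossed_module C ff J alpha lambda),
    (forall i j : nat, (1 <= i <= 2)%N -> (1 <= j <= 2)%N ->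
       lambda (x i j) = i%:R *: pure s (x i j) /\
       alpha (pure s (x i j)) = x i (j - 1)%N) /\
    (exists V W : crossedModule ff, eta_hat V W <> 0) /\
    exists (beta : colorHom (ctens J J) J) (delta : colorHom J (ctens J J)),
      (forall i j : nat, (1 <= i <= 2)%N -> (1 <= j <= 2)%N ->
         beta (pure (x 1%N i) (x 1%N j)) =
           (i + j - 2)%N%:R *: x 2%N (i + j - 2)%N) /\
      (forall (i : nat) (y : J), (1 <= i <= 2)%N ->
         beta (pure (x 2%N i) y) = 0 /\ beta (pure y (x 2%N i)) = 0) /\
      (forall i : nat, (1 <= i <= 2)%N ->
         [/\ delta (x 1%N i) = 0,
             delta (x 2%N i) =
               (chom_tau chi J J - chom_id (ctens J J))
                 (pure (x 1%N 1%N) (x 1%N i))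
           & delta (x 2%N i) =
               - pure (x 1%N 1%N) (x 1%N i) - pure (x 1%N i) (x 1%N 1%N)]) /\
      @is_crossed_lie_bialgebra C ff (CrossedModule J_crossed) beta delta.
Proof.
move=> C ff.
pose e (p : 'I_2 * 'I_2) := x p.1.+1 p.2.+1.
pose d (p : 'I_2 * 'I_2) := g *+ p.1.+1.
have in_ord (i : 'I_2) : (1 <= i.+1 <= 2)%N by rewrite /= ltn_ord.
have e_deg p : homog (d p) (e p) by apply: x_deg.
(* The index j = 0, which the action and the bracket produce, is included. *)
have x_deg0 (i : nat) j :
    (1 <= i <= 2)%N -> (j <= 2)%N -> homog (g *+ i) (x i j).
  by case: j => [|j] hi hj; [rewrite x_0 //; apply: homog0 | apply: x_deg].
have x_spans := basis_spans x_basis; have s_spans := basis_spans s_basis.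
(* Ordinals count from 0: p stands for the basis vector of indices p + 1, so the
   index j - 1 of the shift is p.2, and the bracket index i + j - 2 is the sum of
   the two ordinals. *)
have [alpha alphaE] : exists h : colorHom (ctens f J) J,
    forall (o : 'I_1) p, h (pure s (e p)) = x p.1.+1 p.2.
  apply: (exists_chom2 s_basis x_basis (fun=> s_deg) e_deg) => o p.
  by rewrite add0r; apply: x_deg0 => //; apply/ltnW/ltn_ord.
have [lambda lambdaE] : exists h : colorHom J (ctens f J),
    forall p, h (e p) = p.1.+1%:R *: pure s (e p).
  apply: (exists_chom x_basis e_deg) => p.
  by apply/homogZ; rewrite -[d p]add0r; apply: homog_pure.
have [beta betaE] : exists h : colorHom (ctens J J) J, forall p q,
    h (pure (e p) (e q)) =
    if (p.1 == ord0) && (q.1 == ord0)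
    then (p.2 + q.2)%:R *: x 2%N (p.2 + q.2)%N else 0.
  apply: (exists_chom2 x_basis x_basis e_deg e_deg) => p q.
  case: ifP => [/andP[/eqP p0 /eqP q0]|_]; last exact: homog0.
  rewrite /d p0 q0 -mulrnDr; apply/homogZ/x_deg0 => //.
  by rewrite (leq_add (n1 := 1) (n2 := 1)) // -ltnS ltn_ord.
have [delta deltaE] : exists h : colorHom J (ctens J J), forall p,
    h (e p) = if p.1 == ord0 then 0
              else - pure (x 1%N 1%N) (x 1%N p.2.+1)
                   - pure (x 1%N p.2.+1) (x 1%N 1%N).
  apply: (exists_chom x_basis e_deg) => p.
  case: ifP => [_|p0]; first exact: homog0.
  have -> : d p = g *+ 1 + g *+ 1.
    by rewrite -mulrnDr /d; case: p p0 => [[[|[|//]] ?] ?].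
  by rewrite -!scaleN1r; apply: homogD; apply/homogZ/homog_pure; apply: x_deg.
have lambda_x (i j : nat) : (1 <= i <= 2)%N -> (1 <= j <= 2)%N ->
    lambda (x i j) = i%:R *: pure s (x i j).
  by move: i j; apply: in12_ord => p; apply: lambdaE.
have alpha_x (i j : nat) : (1 <= i <= 2)%N -> (1 <= j <= 2)%N ->
    alpha (pure s (x i j)) = x i (j - 1)%N.
  by move: i j; apply: in12_ord => p; rewrite subn1; apply: (alphaE ord0).
have beta_x1 (i j : nat) : (1 <= i <= 2)%N -> (1 <= j <= 2)%N ->
    beta (pure (x 1%N i) (x 1%N j)) = (i + j - 2)%N%:R *: x 2%N (i + j - 2)%N.
  move: i j; apply: in12_ord => p; rewrite addSn addnS !subSS subn0.
  exact: (betaE (ord0, p.1) (ord0, p.2)).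
have beta_x2 (i : nat) (y : J) : (1 <= i <= 2)%N ->
    beta (pure (x 2%N i) y) = 0 /\ beta (pure y (x 2%N i)) = 0.
  case: i => // i hi; have [c ->] := x_spans y.
  rewrite linear_sumr linear_sumlz !linear_sum /=.
  split; apply: big1 => p _; rewrite (linearZl_LR, linearZr_LR) linearZ /=.
    by rewrite (betaE (lift ord0 ord0, Ordinal hi) p) scaler0.
  by rewrite (betaE p (lift ord0 ord0, Ordinal hi)) andbF scaler0.
have delta_x1 (i : nat) : (1 <= i <= 2)%N -> delta (x 1%N i) = 0.
  by case: i => // i hi; apply: (deltaE (ord0, Ordinal hi)).
have delta_x2 (i : nat) : (1 <= i <= 2)%N ->
    delta (x 2%N i) =
      - pure (x 1%N 1%N) (x 1%N i) - pure (x 1%N i) (x 1%N 1%N).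
  by case: i => // i hi; apply: (deltaE (lift ord0 ord0, Ordinal hi)).
have J_crossed : @is_crossed_module C ff J alpha lambda.
  apply: (is_crossed_module_line (s := s)
    (m := fun p : 'I_2 * 'I_2 => p.1.+1%:R) s_deg s_spans x_spans lambdaE) => p.
  rewrite /weight /app /tpure (alphaE ord0); case: p => i [[|j] hj] /=.
    by rewrite x_0 // !linear0 linear0r scaler0.
  by apply: lambda_x => //; apply: ltnW.
pose V : crossedModule ff := CrossedModule J_crossed.
exists alpha, lambda, J_crossed; split.
  by move=> i j hi hj; rewrite lambda_x ?alpha_x.
split.
  (* eta_hat (x_11 (x) x_12) = x_11 (x) x_11, since s.x_11 = 0. *)
  exists V, V => eta0.
  have [c [_ cE]] := basis_dual x_basis.
  have cx : c (ord0, ord0) (x 1%N 1%N) = 1 by apply: (cE _ (ord0, ord0)).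
  apply: (@pure_neq0 _ _ J J _ _ _ _ cx cx).
  have := eta_hat_x (V := V) s_deg x_deg alpha_x lambda_x
    (i := 1) (j := 1) (a := 1) (b := 2) isT isT isT isT.
  by rewrite eta0 /= x_0 // linear0l mul0rn add0r mulr1n.
exists beta, delta; split; [by [] | split; [by [] | split]].
  move=> i hi; rewrite delta_x1 // delta_x2 //; split=> //.
  rewrite chom_addE chom_oppE chom_idE.
  rewrite (chom_tauE chi (x_deg 1%N 1%N isT isT) (x_deg 1%N i isT hi)).
  by rewrite chi_gg scaleN1r addrC.
exact: (crossed_lie_bialgebra_x (V := V) s_deg s_spans chi_gg x_spans x_deg
  alpha_x lambda_x x_0 beta_x1 beta_x2 delta_x1 delta_x2).
Qed.
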